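(* Let $w=p/q\in(0,1)$ with $p,q$ relatively prime positive integers, and let $N\ge k\ge 2$ be fixed integers. Let $\lambda>0$, let $\Pi$ be a homogeneous Poisson point process of intensity $\lambda$ on $(0,1]$, let $M:=|\Pi|$, and let $\gamma^{(N)}$, $\gamma^{(N-1)}$, $\gamma_n^{(N)}$, $\nu(\Pi)$, $\tilde\nu(\Pi)$ be as defined in the context. Then, as $n\to\infty$ along $n=mq$ $(m=1,2,\dots)$, $$\lim_{n\to\infty}n\left(\gamma^{(N)}-\gamma_n^{(N)}\right)=\frac12N(N-1)\left(\gamma^{(N-1)}-\gamma^{(N)}\right)+\frac12N\,\mathbb{E}\left[\nu(\Pi)+\tilde\nu(\Pi)\,\middle|\,M=N-1\right].$$
   Context: $|\cdot|$ denotes the number of points of a (multi)set, counted with multiplicity. The continuous scan statistic is $S_w=S_w(\Pi):=\max_{0\le t\le 1-w}|\Pi\cap(t,t+w]|$. For an integer $j\ge 0$, $$\gamma^{(j)}:=\mathbb{P}\left(S_w\ge k\mid M=j\right);$$ equivalently, $\gamma^{(j)}$ is the probability that some window $(t,t+w]$, $0\le t\le 1-w$, contains at least $k$ of $j$ i.i.d. uniform random points on $(0,1]$ (conditional on $M=j$, $\Pi$ is distributed as such a set, whatever the value of $\lambda$). For $n=mq$ (so that $nw$ is an integer) with $n\ge N$, let $(J^n_1,\dots,J^n_n)$ be uniformly distributed over the $\binom nN$ vectors in $\{0,1\}^n$ with exactly $N$ entries equal to $1$, and put $$\gamma^{(N)}_n:=\mathbb{P}\left(\max_{i=1,\dots,n-nw+1}\sum_{r=i}^{i+nw-1}J^n_r\ge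 k\right).$$ Write $\Pi=\{Q_1,\dots,Q_M\}$. Almost surely $0<Q_1<\cdots<Q_M<1$, $w\notin\Pi$, $1-w\notin\Pi$, and $Q_j-Q_i\ne w$ for all $1\le i<j\le M$; the following functionals are defined on this almost sure event: $$\nu(\Pi):=\sum_{\{\ell:\,Q_\ell<1-w\}}\mathbf{1}\Big\{S_w<k,\ |\Pi\cap(Q_\ell,Q_\ell+w]|=k-2,\ |\Pi\cap(t,t+w]|\le k-2\text{ for all }t\text{ with }Q_\ell\le t\le Q_\ell+w\Big\},$$ $$\tilde\nu(\Pi):=\sum_{\ell=1}^M\mathbf{1}\Big\{S_w<k,\ \max_{0\le t\le 1-w}|(\Pi\cup\{Q_\ell\})\cap(t,t+w]|=k\Big\},$$ where $\Pi\cup\{Q_\ell\}$ is interpreted as a multiset in which $Q_\ell$ has multiplicity $2$. *)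

(* Defs.v *)
From HB Require Import structures.
From mathcomp Require Import all_boot all_order all_algebra.
From mathcomp Require Import all_classical all_reals all_analysis.

Set Implicit Arguments.
Unset Strict Implicit.
Unset Printing Implicit Defensive.

Import Order.TTheory GRing.Theory Num.Theory.
Import numFieldNormedType.Exports.
Local Open Scope classical_set_scope.
Local Open Scope ring_scope.

(* A finite multiset of points of the line is represented by a sequence that
   enumerates it in an arbitrary order. All the functionals of sequences below
   are invariant under permutation, and [:: Q & s] is s with the multiplicity
   of Q increased by one. *)

(* |s `&` A|, counted with multiplicity. *)
Definition npoints (R : realType) (s : seq R) (A : set R) : nat :=
  count (fun x => x \in A) s.

Record poisson_process (d : measure_display) (T : measurableType d)
    (R : realType) (P : probability T R) (lambda : R) (Pi : T -> seq R) :
    Prop := PoissonProcess {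
  poisson_process_range : forall om x, x \in Pi om -> 0 < x <= 1;
  poisson_process_measurable : forall A : set R, measurable A ->
    measurable_fun [set: T] (fun om => npoints (Pi om) A);
  (* The second argument of poisson_prob is not used by its definition;
     poisson_prob 0 _ is the Dirac measure at 0. *)
  poisson_process_law : forall A : set R, measurable A -> A `<=` `]0, 1] ->
    forall U : set nat, P [set om | U (npoints (Pi om) A)] =
      poisson_prob (lambda * fine (lebesgue_measure A)) 0 U;
  poisson_process_indep : forall (n : nat) (A : 'I_n -> set R),
    (forall i, measurable (A i)) -> (forall i, A i `<=` `]0, 1]) ->
    trivIset [set: 'I_n] A ->
    forall j : 'I_n -> nat,
      P [set om | forall i, npoints (Pi om) (A i) = j i] =
      (\prod_(i < n) P [set om | npoints (Pi om) (A i) = j i])%E }.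

Definition cond_prob (d : measure_display) (T : measurableType d)
    (R : realType) (P : probability T R) (A B : set T) : R :=
  fine (P (A `&` B)) / fine (P B).

Definition cond_expectation (d : measure_display) (T : measurableType d)
    (R : realType) (P : probability T R) (X : T -> R) (B : set T) : R :=
  fine 'E_P[X \* \1_B] / fine (P B).

(* The maximum runs over the (finite) set of values attained by the window
   counts, all of which are at most size s. *)
Definition scan (R : realType) (w : R) (s : seq R) : nat :=
  (\max_(v < (size s).+1 |
      `[< exists2 t : R, (0 <= t <= 1 - w)%R & npoints s `]t, (t + w)%R] = v >])
    v)%N.

Definition gamma (d : measure_display) (T : measurableType d)
    (R : realType) (P : probability T R) (Pi : T -> seq R) (w : R)
    (k j : nat) : R :=
  cond_prob P [set om | (k <= scan w (Pi om))%N] [set om | size (Pi om) = j].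

(* Positions 1, ..., n of the 0-1 vector are indexed by 0, ..., n - 1, and
   the window length l stands for n * w. *)
Definition discrete_scan (n l : nat) (J : {ffun 'I_n -> bool}) : nat :=
  (\max_(i < (n - l).+1) \sum_(r < n | i <= r < i + l) J r)%N.

Definition gamma_discrete (R : realType) (N n l k : nat) : R :=
  #|[set J : {ffun 'I_n -> bool} |
       (\sum_r J r == N)%N && (k <= discrete_scan l J)%N]%SET|%:R
  / #|[set J : {ffun 'I_n -> bool} | (\sum_r J r == N)%N]%SET|%:R.

(* On the null event where the points are not in general position, the sums
   below are still given by the same formulas. *)
Definition nu (R : realType) (w : R) (k : nat) (s : seq R) : nat :=
  (\sum_(Q <- s | (Q < 1 - w)%R)
    `[< [/\ scan w s < k,
            npoints s `](Q : R), (Q + w)%R] = k - 2 &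
            forall t : R, (Q <= t <= Q + w)%R ->
              npoints s `]t, (t + w)%R] <= k - 2] >])%N.

Definition nu_tilde (R : realType) (w : R) (k : nat) (s : seq R) : nat :=
  (\sum_(Q <- s) ((scan w s < k) && (scan w (Q :: s) == k)))%N.

(* Main.v *)
Require Import Defs.
From mathcomp Require Import all_boot all_order all_algebra.
From mathcomp Require Import zify lra ring.
From mathcomp Require Import all_classical all_reals all_analysis.
From mathcomp Require Import measurable_realfun.

(** Cut (0, 1] into n = m q cells of length 1/n, so that a window of length w
    starting at a cell boundary covers exactly l = m p cells.  Conditionally on
    M = N, the cells of the points of the process are distributed as N
    independent uniform choices among the n cells ([prob_grid_event]), so grid
    statistics reduce to counting maps from 'I_N to 'I_n.  Let g(n) be the
    probability that N independent uniform cells have a grid window with at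
    least k points.  The difference between gamma and gamma_discrete splits as
    (gamma - g(n)) + (g(n) - gamma_discrete), and each half is of order 1/n for
    a reason of its own.

    The first half comes from windows that are not aligned with the grid.
    Passing from n to 2n cells, a new window with k points appears when one
    point x lies in the right half of some cell a, another point y in the left
    half of cell a + l, and the N - 1 points other than y satisfy at x the
    condition that nu counts; everything else has probability O(1/n^2)
    ([critical_criterion], [refinement_expansion]).  The two halves cost a factor
    1/4, so n (g(2n) - g(n)) tends to N/4 times the expectation of nu.  Summing
    along n, 2n, 4n, ... multiplies this by 1 + 1/2 + 1/4 + ... = 2
    ([cvg_doubling]), whence the term N/2 E nu.

    The second half comes from points sharing a cell, since gamma_discrete is
    the probability of the same event given that the N cells are distinct
    ([gamma_discreteE]).  Two points collide with probability about
    N (N - 1) / (2n), and a colliding configuration looks like N - 1 points of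
    which a uniformly chosen one is doubled ([coincidence_expansion]): its scan
    reaches k either already without the doubling, or because of it, which is
    what nu_tilde counts.  This yields N/2 E nu_tilde and the term with the
    difference of the gammas.

    Both expansions are instances of [pair_expansion], which replaces the count
    of configurations containing a special pair by a sum over pairs.  Finally a
    configuration in general position with respect to the grid has exactly the
    same scan, nu and nu_tilde as its cells ([scan_grid], [nu_grid],
    [nu_tilde_grid]), and general position fails with probability O(1/n)
    ([grid_bad_bound]), so that expectations over grids converge to those of the
    process. *)

Set Implicit Arguments.
Unset Strict Implicit.
Unset Printing Implicit Defensive.

Import Order.TTheory GRing.Theory Num.Theory.
Import numFieldNormedType.Exports.

(** * Statistics of finite multisets of cells *)

Definition window_count (l : nat) (s : seq nat) (b : nat) : nat :=
  count (fun x => b <= x < b + l) s.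

Definition grid_scan_ge (n l k : nat) (s : seq nat) : bool :=
  has (fun b => k <= window_count l s b) (iota 0 (n - l).+1).

(** General position with respect to the grid.  Two points whose cells differ by
    l may or may not fit in one window, depending on their places inside the
    cells; the difference 2 l plays the same role for the windows starting
    between Q and Q + w in the definition of nu.  The excluded cell is the one
    that contains 1 - w. *)
Definition grid_good (n l : nat) (s : seq nat) : bool :=
  [&& uniq s, all (fun x => (x + l \notin s) && (x + l + l \notin s)) s &
      (n - l).-1 \notin s].

(** The summand of nu at a point of cell a.  An additional point in cell a + l
    may then complete a window of k points beginning inside cell a, while every
    window aligned with the grid keeps fewer than k points. *)
Definition grid_critical (n l k : nat) (s : seq nat) (a : nat) : bool :=
  [&& a < n - l, ~~ grid_scan_ge n l k s,
      count (fun x => a < x < a + l) s == k - 2 &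
      all (fun b => window_count l s b <= k - 2) (iota a.+1 l)].

Definition grid_nu (n l k : nat) (s : seq nat) : nat :=
  \sum_(a <- s) grid_critical n l k s a.

Definition grid_nu_tilde (n l k : nat) (s : seq nat) : nat :=
  \sum_(a <- s) (~~ grid_scan_ge n l k s && grid_scan_ge n l k (a :: s)).

Definition symmetric_stat (S : Type) (F : seq nat -> S) :=
  forall s1 s2, perm_eq s1 s2 -> F s1 = F s2.

Lemma window_count_perm l b : symmetric_stat (fun s => window_count l s b).
Proof. by move=> s1 s2 /permP; apply. Qed.

Lemma grid_scan_ge_sym n l k : symmetric_stat (grid_scan_ge n l k).
Proof.
by move=> s1 s2 s12; apply: eq_has => b; rewrite (window_count_perm l b s12).
Qed.

Lemma grid_good_sym n l : symmetric_stat (grid_good n l).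
Proof.
move=> s1 s2 s12; rewrite /grid_good (perm_uniq s12) (perm_all _ s12).
rewrite (perm_mem s12); congr [&& _, _ & _].
by apply: eq_all => x; rewrite !(perm_mem s12).
Qed.

Lemma grid_critical_sym n l k a :
  symmetric_stat (fun s => grid_critical n l k s a).
Proof.
move=> s1 s2 s12; rewrite /grid_critical (grid_scan_ge_sym _ _ _ s12).
rewrite ((permP s12) _); congr [&& _, _, _ & _].
by apply: eq_all => b; rewrite (window_count_perm l b s12).
Qed.

Lemma grid_nu_sym n l k : symmetric_stat (grid_nu n l k).
Proof.
move=> s1 s2 s12; rewrite /grid_nu (perm_big _ s12) /=.
by apply: eq_bigr => a _; rewrite (grid_critical_sym n l k a s12).
Qed.

Lemma grid_nu_tilde_sym n l k : symmetric_stat (grid_nu_tilde n l k).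
Proof.
move=> s1 s2 s12; rewrite /grid_nu_tilde (perm_big _ s12) /=.
apply: eq_bigr => a _; rewrite (grid_scan_ge_sym _ _ _ s12).
by rewrite (@grid_scan_ge_sym n l k (a :: s1) (a :: s2)) // perm_cons.
Qed.

(** * Independent uniform choices of cells *)

(** Sequences of naturals, so that choices on grids of different sizes and the
    cells of real points have a common type. *)
Definition cells (n N : nat) (f : {ffun 'I_N -> 'I_n}) : seq nat :=
  [seq nat_of_ord (f i) | i <- enum 'I_N].

Definition total (n N : nat) (F : seq nat -> nat) : nat :=
  \sum_(f : {ffun 'I_N -> 'I_n}) F (cells f).

Lemma size_cells n N (f : {ffun 'I_N -> 'I_n}) : size (cells f) = N.
Proof. by rewrite size_map -cardE card_ord. Qed.

Lemma big_cells n N (f : {ffun 'I_N -> 'I_n}) (F : nat -> nat) :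
  \sum_(a <- cells f) F a = \sum_i F (f i).
Proof. by rewrite big_map big_enum. Qed.

Definition ffremove (T : finType) K (j : 'I_K.+1) (f : {ffun 'I_K.+1 -> T}) :
  {ffun 'I_K -> T} := [ffun i => f (lift j i)].

Definition ffinsert (T : finType) K (j : 'I_K.+1) (y : T)
    (g : {ffun 'I_K -> T}) : {ffun 'I_K.+1 -> T} :=
  [ffun i => if unlift j i is Some i' then g i' else y].

Lemma ffinsertK (T : finType) K (j : 'I_K.+1) (y : T) g :
  ffremove j (ffinsert j y g) = g.
Proof. by apply/ffunP => i; rewrite !ffunE liftK. Qed.

Lemma ffinsert_at (T : finType) K (j : 'I_K.+1) (y : T) g :
  ffinsert j y g j = y.
Proof. by rewrite ffunE unlift_none. Qed.

Lemma ffinsert_lift (T : finType) K (j : 'I_K.+1) (y : T) g i :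
  ffinsert j y g (lift j i) = g i.
Proof. by rewrite ffunE liftK. Qed.

Lemma ffremoveK (T : finType) K (j : 'I_K.+1) (f : {ffun 'I_K.+1 -> T}) :
  ffinsert j (f j) (ffremove j f) = f.
Proof.
apply/ffunP => i; rewrite ffunE.
by case: unliftP => [i' ->|->//]; rewrite ffunE.
Qed.

Lemma sum_ffun_split (T : finType) K (j : 'I_K.+1)
    (F : {ffun 'I_K.+1 -> T} -> nat) :
  \sum_f F f = \sum_(g : {ffun 'I_K -> T}) \sum_y F (ffinsert j y g).
Proof.
rewrite pair_big /=.
rewrite (reindex (fun u : {ffun 'I_K -> T} * T => ffinsert j u.2 u.1)) //=.
exists (fun f => (ffremove j f, f j)) => [[g y] _ | f _] /=.
  by rewrite ffinsertK ffinsert_at.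
exact: ffremoveK.
Qed.

Lemma perm_enum_ord_lift K (j : 'I_K.+1) :
  perm_eq (enum 'I_K.+1) (j :: [seq lift j i | i <- enum 'I_K]).
Proof.
apply: uniq_perm.
- exact: enum_uniq.
- rewrite /= map_inj_uniq ?enum_uniq ?andbT; last exact: lift_inj.
  by apply/mapP => -[i _ /eqP]; rewrite (negPf (neq_lift j i)).
move=> x; rewrite mem_enum [RHS]in_cons; apply/esym.
case: (unliftP j x) => [x' ->|->]; last by rewrite eqxx.
by rewrite map_f ?orbT // mem_enum.
Qed.

Lemma cells_perm_remove n K (j : 'I_K.+1) (f : {ffun 'I_K.+1 -> 'I_n}) :
  perm_eq (cells f) (nat_of_ord (f j) :: cells (ffremove j f)).
Proof.
rewrite (perm_trans (perm_map _ (perm_enum_ord_lift j))) //=.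
rewrite perm_cons /cells -map_comp.
set s1 := map _ _; set s2 := map _ _; suff -> : s1 = s2 by exact: perm_refl.
by apply: eq_map => i /=; rewrite ffunE.
Qed.

(** * Sums over a distinguished pair *)

Section PairExpansion.
Variables (K : nat) (T : finType).
Variables (A : pred {ffun 'I_K.+1 -> T}) (r : rel T) (c : nat).
Variables (phi : 'I_K -> pred {ffun 'I_K -> T}) (bad : pred {ffun 'I_K -> T}).

Let rp (f : {ffun 'I_K.+1 -> T}) j i := r (f (lift j i)) (f j).

(** Deleting coordinate j leaves K free coordinates, and the value of the i-th of
    them decides how many values of coordinate j are related to it. *)
Lemma sum_related (psi : 'I_K -> pred {ffun 'I_K -> T}) :
  \sum_f \sum_j \sum_i (rp f j i && psi i (ffremove j f) : nat) =
  K.+1 * \sum_i \sum_g (psi i g * #|[pred y | r (g i) y]|).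
Proof.
rewrite exchange_big /=.
rewrite (eq_bigr (fun=> \sum_i \sum_g (psi i g * #|[pred y | r (g i) y]|))).
  by rewrite sum_nat_const card_ord.
move=> j _; rewrite exchange_big /=; apply: eq_bigr => i _.
rewrite (sum_ffun_split j); apply: eq_bigr => g _.
rewrite -sum1_card big_distrr /= [RHS]big_mkcond /=; apply: eq_bigr => y _.
rewrite ffinsertK /rp ffinsert_at ffinsert_lift inE.
by case: r; case: psi.
Qed.

Hypothesis c_gt0 : 0 < c.
Hypothesis A_related : forall f, A f -> exists j, exists i, rp f j i.
Hypothesis A_good : forall f j i, rp f j i -> ~~ bad (ffremove j f) ->
  c * A f = \sum_j' \sum_i' (rp f j' i' && phi i' (ffremove j' f) : nat).

Let main := \sum_f \sum_j \sum_i (rp f j i && phi i (ffremove j f) : nat).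
Let err := \sum_f \sum_j \sum_i (rp f j i && bad (ffremove j f) : nat).

(** The hypothesis on good configurations is met when the related pair is unique:
    a sum over pairs then sees each configuration of A once (c = 1) or, if the
    relation is symmetric, twice (c = 2).  A configuration whose related
    pairs are all bad weighs at most c on one side and at most its number of
    pairs on the other, and the error term counts these pairs. *)
Lemma pair_expansion :
  (c * \sum_f A f <= main + c * err) /\ (main <= c * (\sum_f A f) + c * err).
Proof.
suff H f : let mf := \sum_j \sum_i (rp f j i && phi i (ffremove j f) : nat) in
   let ef := \sum_j \sum_i (rp f j i && bad (ffremove j f) : nat) in
   (c * A f <= mf + c * ef) /\ (mf <= c * A f + c * ef).
  split; rewrite /main /err !big_distrr /= -big_split /=; apply: leq_sum => f _;
    by case: (H f).
move=> mf ef.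
have [good|allbad] := boolP [exists j, exists i, rp f j i && ~~ bad (ffremove j f)].
  case/existsP: good => j /existsP[i /andP[rji gd]].
  by rewrite (A_good rji gd); split; apply: leq_addr.
have rbad j i : rp f j i -> bad (ffremove j f).
  move=> rji; apply: contraNT allbad => gd.
  by apply/existsP; exists j; apply/existsP; exists i; rewrite rji.
have efE : ef = \sum_j \sum_i (rp f j i : nat).
  apply: eq_bigr => j _; apply: eq_bigr => i _.
  by case: (boolP (rp f j i)) => // /rbad ->.
have mef : mf <= ef.
  rewrite efE; apply: leq_sum => j _; apply: leq_sum => i _.
  by case: rp; case: phi.
have Aef : A f <= ef.
  case: (boolP (A f)) => // /A_related[j [i rji]]; rewrite efE.
  by rewrite (bigD1 j) //= (bigD1 i) //= rji.
split.
  by apply: leq_trans (leq_addl _ _); rewrite leq_mul2l Aef orbT.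
apply: leq_trans (leq_addl _ _); apply: leq_trans mef _.
by rewrite leq_pmull.
Qed.

End PairExpansion.

(** * Two points in the same cell *)

Lemma sum_bool_count (I : Type) (s : seq I) (p : pred I) :
  \sum_(a <- s) (p a : nat) = count p s.
Proof. by elim: s => [|a s IH]; rewrite ?big_nil // big_cons IH. Qed.

Lemma sum_bool_card (I : finType) (p : pred I) : \sum_a (p a : nat) = #|p|.
Proof.
rewrite -sum1_card [RHS]big_mkcond /=; apply: eq_bigr => a _.
by rewrite -topredE /=; case: (p a).
Qed.

Lemma total_le n N (F G : seq nat -> nat) :
  (forall f : {ffun 'I_N -> 'I_n}, F (cells f) <= G (cells f)) ->
  total n N F <= total n N G.
Proof. by move=> FG; apply: leq_sum => f _. Qed.

Lemma cells_uniqP n N (f : {ffun 'I_N -> 'I_n}) :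
  reflect (injective f) (uniq (cells f)).
Proof.
rewrite /cells map_comp map_inj_uniq; last exact: val_inj.
apply: (iffP idP) => [/injectiveP //|/injectiveP]; exact.
Qed.

Lemma mem_cells n N (f : {ffun 'I_N -> 'I_n}) x :
  reflect (exists i, x = f i :> nat) (x \in cells f).
Proof.
apply: (iffP (@mapP _ _ (fun i => nat_of_ord (f i)) _ _)) => [[i _ ->]|[i ->]].
  by exists i.
by exists i; rewrite ?mem_enum.
Qed.

Lemma cells_lt n N (f : {ffun 'I_N -> 'I_n}) x : x \in cells f -> x < n.
Proof. by case/mem_cells => i ->. Qed.

Lemma ffun_lift_related (T : finType) K (f : {ffun 'I_K.+1 -> T}) (r : rel T) a b :
  a != b -> r (f a) (f b) -> exists j, exists i, r (f (lift j i)) (f j).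
Proof.
move=> ab rab; exists b.
by case: (unliftP b a) => [i e|e]; [exists i; rewrite -e|rewrite e eqxx in ab].
Qed.

Lemma card_ord_eq n (c : nat) : #|[pred y : 'I_n | y == c :> nat]| <= 1.
Proof.
apply/card_le1_eqP => x y.
by rewrite !inE => /eqP xc /eqP yc; apply: val_inj; rewrite /= xc yc.
Qed.

Section Coincidence.
Variables (n K : nat) (U : pred (seq nat)).
Hypothesis symU : symmetric_stat U.

Let A s := ~~ uniq s && U s.
Let F s := \sum_(a <- s) U (a :: s).

(** If two points share a cell and the configuration is otherwise free of
    coincidences, removing one of the two leaves distinct cells among which one
    is to be doubled.  Each colliding pair is met in both orders, hence the
    factor 2. *)
Lemma coincidence_expansion :
  2 * total n K.+1 A <=
    K.+1 * total n K F + 2 * (K.+1 * (K * total n K (fun s => ~~ uniq s))) /\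
  K.+1 * total n K F <=
    2 * total n K.+1 A + 2 * (K.+1 * (K * total n K (fun s => ~~ uniq s))).
Proof.
have card_eq (x : 'I_n) : #|[pred y | x == y]| = 1.
  by rewrite -(card1 x); apply: eq_card => y; rewrite !inE eq_sym.
pose phi i (g : {ffun 'I_K -> 'I_n}) := U (nat_of_ord (g i) :: cells g).
pose bad (g : {ffun 'I_K -> 'I_n}) := ~~ uniq (cells g).
have mainE : K.+1 * total n K F = K.+1 * \sum_i \sum_g (phi i g * #|[pred y | g i == y]|).
  congr (_ * _); rewrite exchange_big /=; apply: eq_bigr => g _.
  by rewrite /F big_cells; apply: eq_bigr => i _; rewrite card_eq muln1.
have errE : K.+1 * (K * total n K (fun s => ~~ uniq s)) =
   K.+1 * \sum_(i < K) \sum_g (bad g * #|[pred y | g i == y]|).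
  rewrite (eq_bigr (fun=> total n K (fun s => ~~ uniq s))); last first.
    by move=> i _; apply: eq_bigr => g _; rewrite card_eq muln1.
  by rewrite sum_nat_const card_ord.
rewrite mainE errE -(sum_related eq_op phi) -(sum_related eq_op (fun=> bad)).
apply: (@pair_expansion K _ (fun f => A (cells f)) eq_op 2 phi bad) => // [f|f j i].
  case/andP => nu _; move: nu; rewrite (sameP (cells_uniqP f) (injectiveP f)).
  by case/injectivePn => a [b ab /eqP fab]; apply: ffun_lift_related ab fab.
move=> /eqP fji; rewrite /bad negbK => ug.
have pf := cells_perm_remove j f.
set g := ffremove j f in ug pf.
have fjg : nat_of_ord (f j) \in cells g.
  by apply/mem_cells; exists i; rewrite ffunE fji.
have -> : A (cells f) = U (cells f).
  by rewrite /A (perm_uniq pf) /= fjg.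
have -> : \sum_j' \sum_i' ((f (lift j' i') == f j') && phi i' (ffremove j' f) : nat) =
   \sum_j' (U (cells f) * (count_mem (nat_of_ord (f j')) (cells f)).-1).
  apply: eq_bigr => j' _.
  rewrite ((permP (cells_perm_remove j' f)) _) /= eqxx add1n /=.
  rewrite -sum1_count [X in _ * X]big_mkcond big_cells big_distrr /=; apply: eq_bigr => i' _.
  rewrite ffunE -val_eqE /=; case: eqP => [e|_]; last by rewrite muln0.
  rewrite muln1 /phi ffunE e; congr (nat_of_bool _); apply: symU.
  by rewrite perm_sym cells_perm_remove.
rewrite -big_distrr /= -(big_cells f (fun a => (count_mem a (cells f)).-1)) mulnC.
congr (_ * _); rewrite (perm_big _ pf) big_cons /=.
have cE a : count_mem a (cells f) = (nat_of_ord (f j) == a) + (a \in cells g).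
  by rewrite ((permP pf) _) /= (count_uniq_mem _ ug).
rewrite cE eqxx fjg /=.
rewrite (eq_big_seq (fun a => (a == nat_of_ord (f j) : nat))); last first.
  by move=> a ag; rewrite cE ag addn1 eq_sym.
by rewrite sum_bool_count (count_uniq_mem _ ug) fjg.
Qed.

End Coincidence.

(** * Configurations not in general position *)

(** Given one point, at most 3 of the n cells are forbidden to another one, and
    1 of the n cells is forbidden outright; there are at most K ^ 2 ordered
    pairs, and K points. *)
Lemma grid_bad_bound n l K : 0 < l ->
  n * total n K (fun s => ~~ grid_good n l s) <= 4 * K ^ 2 * n ^ K.
Proof.
move=> l0; case: K => [|K].
  rewrite /total big1 ?muln0 // => f _.
  have -> : cells f = [::] by apply: size0nil; rewrite size_cells.
  by rewrite /grid_good.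
pose r (x y : 'I_n) := [|| y == x :> nat, y == x + l :> nat | y == x + l + l :> nat].
pose c := (n - l).-1.
have step (f : {ffun 'I_K.+1 -> 'I_n}) : ~~ grid_good n l (cells f) <=
   \sum_j \sum_i (r (f (lift j i)) (f j) && true : nat) + \sum_j (f j == c :> nat).
  case: (boolP (grid_good _ _ _)) => // ngood.
  have [/existsP[j fj]|noc] := boolP [exists j, f j == c :> nat].
    by apply: leq_trans (leq_addl _ _); rewrite (bigD1 j) //= fj.
  suff [j [i rji]] : exists j, exists i, r (f (lift j i)) (f j).
    by apply: leq_trans (leq_addr _ _); rewrite (bigD1 j) //= (bigD1 i) //= rji.
  move: ngood; rewrite /grid_good !negb_and.
  case/or3P => [nu|/allPn[x /mem_cells[a ->]]|].
  - move: nu; rewrite (sameP (cells_uniqP f) (injectiveP f)).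
    case/injectivePn => a [b ab fab]; apply: (@ffun_lift_related _ _ f r a b ab).
    by rewrite /r fab eqxx.
  - rewrite negb_and !negbK => /orP[] /mem_cells[b fb].
      apply: (@ffun_lift_related _ _ f r a b); last by rewrite /r fb eqxx !orbT.
      by apply/eqP => e; move: fb l0; rewrite e; lia.
    apply: (@ffun_lift_related _ _ f r a b); last by rewrite /r fb eqxx !orbT.
    by apply/eqP => e; move: fb l0; rewrite e; lia.
  - rewrite negbK => /mem_cells[a fa]; case/negP: noc; apply/existsP; exists a.
    by rewrite /c fa.
have deg (x : 'I_n) : #|[pred y | r x y]| <= 3.
  pose p d := [pred y : 'I_n | y == d :> nat].
  apply: leq_trans (_ : #|[predU p x & [predU p (x + l) & p (x + l + l)]]| <= _).
    by apply: subset_leq_card; apply/fintype.subsetP => y; rewrite !inE.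
  apply: leq_trans (_ : #|p x| + (#|p (x + l)| + #|p (x + l + l)|) <= _).
    apply: leq_trans (_ : #|p x| + #|[predU p (x + l) & p (x + l + l)]| <= _).
      by rewrite -cardUI leq_addr.
    by rewrite leq_add2l -cardUI leq_addr.
  by apply: (@leq_add _ _ 1 2); rewrite ?card_ord_eq // (@leq_add _ _ 1 1) ?card_ord_eq.
have cardg : #|{: {ffun 'I_K -> 'I_n}}| = n ^ K by rewrite card_ffun !card_ord.
have main : \sum_(f : {ffun 'I_K.+1 -> 'I_n}) \sum_j \sum_i (r (f (lift j i)) (f j) && true : nat)
   <= K.+1 * (K * (n ^ K * 3)).
  rewrite (sum_related r (fun _ _ => true)) leq_mul2l /=.
  have -> : K * (n ^ K * 3) = \sum_(i < K) (n ^ K * 3).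
    by rewrite sum_nat_const card_ord.
  apply: leq_sum => i _; rewrite -cardg -sum_nat_const; apply: leq_sum => g _.
  by rewrite mul1n.
have bdry : \sum_(f : {ffun 'I_K.+1 -> 'I_n}) \sum_j (f j == c :> nat) <= K.+1 * n ^ K.
  rewrite exchange_big /= -[K.+1 in leqRHS]card_ord -sum_nat_const; apply: leq_sum => j _.
  rewrite (sum_ffun_split j) -cardg -[leqRHS]muln1 -sum_nat_const; apply: leq_sum => g _.
  rewrite (eq_bigr (fun y : 'I_n => (y == c :> nat) : nat)); last first.
    by move=> y _; rewrite ffinsert_at.
  by rewrite sum_bool_card card_ord_eq.
rewrite (expnS n) mulnCA leq_mul2l; apply/orP; right.
apply: leq_trans (_ : K.+1 * (K * (n ^ K * 3)) + K.+1 * n ^ K <= _); last by nia.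
apply: leq_trans (leq_add main bdry); rewrite -big_split /=.
exact: leq_sum.
Qed.

(** * Halving the cells *)

Lemma count_split (T : eqType) (p p1 p2 : pred T) (s : seq T) :
  (forall x, x \in s -> (p x : nat) = p1 x + p2 x) ->
  count p s = count p1 s + count p2 s.
Proof.
elim: s => //= x s IH H; rewrite IH => [|y ys]; last by rewrite H // inE ys orbT.
by rewrite H ?mem_head // addnACA.
Qed.

Lemma count_le_in (T : eqType) (p p1 : pred T) (s : seq T) :
  (forall x, x \in s -> p x -> p1 x) -> count p s <= count p1 s.
Proof.
elim: s => //= x s IH H; apply: leq_add; last first.
  by apply: IH => y ys; apply: H; rewrite inE ys orbT.
by have := H x (mem_head _ _); case: (p x) => // ->.
Qed.

Lemma grid_scanP n l k s :
  reflect (exists2 b, b <= n - l & k <= window_count l s b) (grid_scan_ge n l k s).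
Proof.
apply: (iffP hasP) => [[b]|[b bn kb]].
  by rewrite mem_iota add0n ltnS => /andP[_ bn] kb; exists b.
by exists b => //; rewrite mem_iota add0n ltnS.
Qed.

Lemma grid_scanPn n l k s :
  reflect (forall b, b <= n - l -> window_count l s b < k) (~~ grid_scan_ge n l k s).
Proof.
apply: (iffP hasPn) => H b; have := H b; rewrite mem_iota add0n ltnS -ltnNge.
  exact.
by move=> h /andP[_ /h].
Qed.

Lemma window_count_map_half l s b : window_count l (map half s) b
  = window_count (2 * l) s (2 * b).
Proof. by rewrite /window_count count_map; apply: eq_count => x /=; lia. Qed.

Lemma grid_scan_half n l k s :
  grid_scan_ge n l k (map half s) -> grid_scan_ge (2 * n) (2 * l) k s.
Proof.
case/grid_scanP => b bn; rewrite window_count_map_half => kb.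
by apply/grid_scanP; exists (2 * b) => //; lia.
Qed.

(** A fine window starting at an even cell is a coarse window.  One starting at
    the odd cell 2 b + 1 lies in the coarse window b if its last cell is empty,
    and in the coarse window b + 1 if its first cell is empty. *)
Lemma odd_window_ends n l k s : 0 < l ->
  grid_scan_ge (2 * n) (2 * l) k s -> ~~ grid_scan_ge n l k (map half s) ->
  exists b, [/\ b < n - l, k <= window_count (2 * l) s (2 * b).+1,
    (2 * b).+1 \in s & 2 * (b + l) \in s].
Proof.
move=> l0 /grid_scanP[c cn kc] /grid_scanPn nos.
have /eqP oc : c == (2 * c./2).+1.
  apply/negPn/negP => ec; have ce : c = 2 * c./2 by lia.
  have := nos c./2; rewrite window_count_map_half -ce ltnNge kc => /(_ _)/negP; apply=> //.
  by lia.
set b := c./2 in oc; exists b; split; [lia|by rewrite -oc| |].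
- apply/negPn/negP => nb; suff: k <= window_count (2 * l) s (2 * b.+1).
    by have := nos b.+1; rewrite window_count_map_half; lia.
  apply: leq_trans kc _; apply: count_le_in => x xs xw.
  have : x != (2 * b).+1 by apply: contraNneq nb => <-.
  by move: xw; rewrite oc; lia.
- apply/negPn/negP => nb; suff: k <= window_count (2 * l) s (2 * b).
    by have := nos b; rewrite window_count_map_half; lia.
  apply: leq_trans kc _; apply: count_le_in => x xs xw.
  have : x != 2 * (b + l) by apply: contraNneq nb => <-.
  by move: xw; rewrite oc; lia.
Qed.

(** x is the right half of a coarse cell and y the left half of the coarse cell
    l places further: both fit in a fine window of 2 l cells, but in no coarse
    window of l cells. *)
Definition touching (l x y : nat) : bool :=
  [&& odd x, ~~ odd y & y./2 == x./2 + l].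

Lemma grid_good_diff n l s x : grid_good n l s -> x \in s -> x + l \notin s.
Proof. by case/and3P => _ /allP good _ /good /andP[]. Qed.

Lemma mem_half (s : seq nat) x : x \in s -> x./2 \in map half s.
Proof. exact: map_f. Qed.

Lemma uniq_map_inj (T S : eqType) (f : T -> S) (s : seq T) :
  uniq (map f s) -> {in s &, injective f}.
Proof.
elim: s => //= x s IH /andP[nfx /IH{}IH] y z.
rewrite !inE => /predU1P[->|ys] /predU1P[->|zs] // e.
- by case/negP: nfx; rewrite e map_f.
- by case/negP: nfx; rewrite -e map_f.
- exact: IH.
Qed.

(** The new window can only start at x and end at y, and it holds k points
    exactly when k - 2 points lie between the two coarse cells.  The coarse
    windows that contain y and not x start in (a, a + l]; they stay below k
    exactly when they hold at most k - 2 points besides y.  Windows starting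
    beyond n - l hold no more points than the last admissible one. *)
Lemma critical_criterion n l k s x y : 0 < l -> 2 <= k ->
  grid_good n l (map half s) -> {in s, forall z, z < 2 * n} -> y < 2 * n ->
  x \in s -> touching l x y ->
  grid_scan_ge (2 * n) (2 * l) k (y :: s) &&
    ~~ grid_scan_ge n l k (map half (y :: s)) =
  grid_critical n l k (map half s) x./2.
Proof.
move=> l0 k2 good sn yn xs /and3P[ox ey /eqP yx].
set hs := map half s in good *; set a := x./2 in yx *.
have ahs : a \in hs by apply: mem_half.
have alhs : a + l \notin hs := grid_good_diff good ahs.
have hsn z : z \in hs -> z < n by case/mapP => u /sn un ->; lia.
have uhs : uniq hs by case/and3P: good.
have counta : count_mem a hs = 1 by rewrite count_uniq_mem ?ahs.
pose C := count (fun z => a < z < a + l) hs.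
have winhs : window_count l hs a = C.+1.
  rewrite -add1n -counta; apply: count_split => z _ /=; lia.
have win2 : window_count (2 * l) (y :: s) (2 * a).+1 = C.+2.
  rewrite {1}/window_count /= -/(window_count (2 * l) s (2 * a).+1).
  have -> : window_count (2 * l) s (2 * a).+1 = window_count l hs a.
    rewrite /window_count count_map; apply/eqP; rewrite eqn_leq; apply/andP; split.
      apply: count_le_in => z zs /= zw.
      have : z./2 != a + l by apply: contraNneq alhs => <-; apply: mem_half.
      by lia.
    apply: count_le_in => z zs /= zw.
    have zx : z./2 = a -> z = x by move=> za; apply: (uniq_map_inj uhs).
    by move: zx zw; rewrite /a; lia.
  by rewrite winhs /C; lia.
have winy b : window_count l (map half (y :: s)) b = (b <= a + l < b + l) + window_count l hs b.
  by rewrite /window_count /= yx.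
rewrite /grid_critical -/C; apply/andP/and4P.
- case=> sc2 nsc; have nsc' := grid_scanPn _ _ _ _ nsc.
  have [b [bn kb odd_in even_in]] := odd_window_ends l0 sc2 nsc.
  have {}odd_in : (2 * b).+1 \in s.
    by move: odd_in; rewrite inE => /predU1P[e|//]; clear -e ey; lia.
  have ebl : 2 * (b + l) = y.
    move: even_in; rewrite inE => /predU1P[//|e].
    have := grid_good_diff good (mem_half odd_in); have := mem_half e.
    have -> : (2 * b).+1./2 + l = (2 * (b + l))./2 by clear; lia.
    by move=> h /negP[].
  have {ebl} ba : b = a by clear -ebl yx; lia.
  rewrite ba win2 in kb bn; have := nsc' a; rewrite winy winhs => Ca.
  split.
  + exact: bn.
  + apply/grid_scanPn => c /nsc'; rewrite winy; exact/leq_ltn_trans/leq_addl.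
  + by clear -l0 k2 kb bn Ca; lia.
  + apply/allP => c; rewrite mem_iota => ac.
    have [cn|cn] := leqP c (n - l).
      by have := nsc' c cn; rewrite winy; clear -ac; lia.
    apply: leq_trans (_ : window_count l hs (n - l) <= _).
      by apply: count_le_in => z /hsn; clear -cn; lia.
    by have := nsc' (n - l) (leqnn _); rewrite winy; clear -ac bn cn; lia.
- case=> an /grid_scanPn nos /eqP Ck /allP allw; split.
    by apply/grid_scanP; exists (2 * a).+1; rewrite ?win2; clear -k2 an Ck; lia.
  apply/grid_scanPn => b bn; rewrite winy; have := nos b bn.
  by have := allw b; rewrite mem_iota; clear -k2; lia.
Qed.

Lemma half_ord_subproof n (x : 'I_(2 * n)) : x./2 < n.
Proof. by have := ltn_ord x; lia. Qed.

Definition half_ord n (x : 'I_(2 * n)) : 'I_n := Ordinal (half_ord_subproof x).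

Definition halve n N (f : {ffun 'I_N -> 'I_(2 * n)}) : {ffun 'I_N -> 'I_n} :=
  [ffun i => half_ord (f i)].

Lemma cells_halve n N (f : {ffun 'I_N -> 'I_(2 * n)}) :
  cells (halve f) = map half (cells f).
Proof.
by rewrite /cells -map_comp; apply: eq_map => i /=; rewrite ffunE.
Qed.

Lemma sum_ord_double n (w : nat -> nat) (c : 'I_n) :
  \sum_(x : 'I_(2 * n) | half_ord x == c) w x = w (2 * c) + w (2 * c).+1.
Proof.
have lt0 : 2 * c < 2 * n by have := ltn_ord c; lia.
have lt1 : (2 * c).+1 < 2 * n by have := ltn_ord c; lia.
rewrite (bigD1 (Ordinal lt0)) /=; last by rewrite -val_eqE /=; lia.
rewrite (bigD1 (Ordinal lt1)) /=; last by rewrite -!val_eqE /=; lia.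
rewrite big1 ?addn0 // => x; rewrite -!val_eqE /=; lia.
Qed.

(** Once the coarse cells are fixed, the halves are chosen independently, so the
    sum over the fibre is a product of sums over two halves. *)
Lemma sum_halve_weight n N (w : 'I_N -> nat -> nat) (F : {ffun 'I_N -> 'I_n} -> nat) :
  \sum_(g : {ffun 'I_N -> 'I_(2 * n)}) (\prod_i w i (g i)) * F (halve g) =
  \sum_(h : {ffun 'I_N -> 'I_n}) (\prod_i (w i (2 * h i) + w i (2 * h i).+1)) * F h.
Proof.
rewrite (partition_big (@halve n N) predT) //=; apply: eq_bigr => h _.
rewrite (eq_bigr (fun g : {ffun 'I_N -> 'I_(2 * n)} => (\prod_i w i (g i)) * F h)); last first.
  by move=> g /eqP ->.
rewrite -big_distrl /=; congr (_ * _).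
under [RHS]eq_bigr do rewrite -sum_ord_double.
rewrite bigA_distr_big_dep /=; apply: eq_bigl => g.
apply/eqP/familyP => [<- i|H]; first by rewrite unfold_in ffunE.
by apply/ffunP => i; rewrite ffunE; apply/eqP/H.
Qed.

Lemma sum_halve n N (F : {ffun 'I_N -> 'I_n} -> nat) :
  \sum_(g : {ffun 'I_N -> 'I_(2 * n)}) F (halve g) = 2 ^ N * \sum_h F h.
Proof.
rewrite (eq_bigr (fun g : {ffun 'I_N -> 'I_(2 * n)} => (\prod_(i < N) 1) * F (halve g)));
  last first.
  by move=> g _; rewrite big1_eq mul1n.
rewrite (sum_halve_weight (fun _ _ => 1)) big_distrr /=; apply: eq_bigr => h _.
by rewrite prod_nat_const card_ord.
Qed.

Lemma sum_halve_odd n N (i : 'I_N) (F : {ffun 'I_N -> 'I_n} -> nat) :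
  2 * \sum_(g : {ffun 'I_N -> 'I_(2 * n)}) odd (g i) * F (halve g) = 2 ^ N * \sum_h F h.
Proof.
pose w j x := if j == i then (odd x : nat) else 1.
rewrite (eq_bigr (fun g : {ffun 'I_N -> 'I_(2 * n)} => (\prod_j w j (g j)) * F (halve g)));
  last first.
  move=> g _; rewrite (bigD1 i) //= {1}/w eqxx big1 ?muln1 // => j.
  by rewrite /w => /negPf->.
rewrite (sum_halve_weight w) !big_distrr /=; apply: eq_bigr => h _.
rewrite mulnA; congr (_ * _).
rewrite (bigD1 i) //= {1 2}/w eqxx.
rewrite (eq_bigr (fun=> 2)) => [|j]; last by rewrite /w => /negPf->.
rewrite prod_nat_const cardC1 card_ord -[in RHS](prednK (leq_ltn_trans (leq0n i) (ltn_ord i)))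
  expnS.
by have -> : odd (2 * h i) + odd (2 * h i).+1 = 1; [lia | rewrite mul1n].
Qed.

Lemma total_halve n N (F : seq nat -> nat) :
  total (2 * n) N (fun s => F (map half s)) = 2 ^ N * total n N F.
Proof.
by rewrite /total -sum_halve; apply: eq_bigr => f _; rewrite cells_halve.
Qed.

Section Refinement.
Variables (n l k K : nat).
Hypotheses (l_gt0 : 0 < l) (k_ge2 : 2 <= k).

Definition refined_only (s : seq nat) :=
  grid_scan_ge (2 * n) (2 * l) k s && ~~ grid_scan_ge n l k (map half s).

Lemma total_scan_refine N :
  total (2 * n) N (grid_scan_ge (2 * n) (2 * l) k) =
  2 ^ N * total n N (grid_scan_ge n l k) + total (2 * n) N refined_only.
Proof.
rewrite -total_halve -big_split; apply: eq_bigr => f _ /=.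
rewrite /refined_only; set s := cells f.
have := @grid_scan_half n l k s.
by case: (grid_scan_ge n l k _) => [->|_] //; rewrite andbT.
Qed.

Let r (x y : 'I_(2 * n)) := touching l x y.
Let bad s := ~~ grid_good n l s.

Lemma card_touching (x : 'I_(2 * n)) :
  #|[pred y | r x y]| = odd x && (x./2 < n - l).
Proof.
have [/andP[ox xn]|no] := boolP (_ && _).
  have yn : 2 * (x./2 + l) < 2 * n by lia.
  transitivity #|pred1 (Ordinal yn)|; last exact: card1.
  apply: eq_card => y.
  by rewrite !inE -val_eqE /r /touching /=; lia.
by apply: eq_card0 => y; rewrite !inE /r /touching; have := ltn_ord y; lia.
Qed.

(** In a touching pair, y is determined by x, and x must be a right half: this
    holds for one half of the choices above a coarse configuration, hence the
    factor 2 on the left. *)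
Lemma refinement_expansion :
  2 * total (2 * n) K.+1 refined_only <=
    K.+1 * 2 ^ K * total n K (grid_nu n l k) +
    2 * (K.+1 * (K * (2 ^ K * total n K (fun s => ~~ grid_good n l s)))) /\
  K.+1 * 2 ^ K * total n K (grid_nu n l k) <=
    2 * total (2 * n) K.+1 refined_only +
    2 * (K.+1 * (K * (2 ^ K * total n K (fun s => ~~ grid_good n l s)))).
Proof.
pose phi i (g : {ffun 'I_K -> 'I_(2 * n)}) :=
  grid_critical n l k (cells (halve g)) (halve g i).
pose badg (g : {ffun 'I_K -> 'I_(2 * n)}) := bad (cells (halve g)).
have mainE : K.+1 * 2 ^ K * total n K (grid_nu n l k) =
   2 * (K.+1 * \sum_i \sum_g (phi i g * #|[pred y | r (g i) y]|)).
  rewrite -mulnA [RHS]mulnCA; congr (_ * _).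
  have -> : total n K (grid_nu n l k) =
      \sum_i \sum_(h : {ffun 'I_K -> 'I_n}) grid_critical n l k (cells h) (h i).
    by rewrite exchange_big /=; apply: eq_bigr => h _; rewrite /grid_nu big_cells.
  rewrite !big_distrr /=; apply: eq_bigr => i _.
  rewrite -(sum_halve_odd i (fun h => grid_critical n l k (cells h) (h i) : nat)).
  congr (_ * _); apply: eq_bigr => g _; rewrite card_touching mulnC /phi.
  by rewrite ffunE /= /grid_critical; case: (_ < n - l); rewrite ?andbT ?andbF.
have errL : K.+1 * \sum_(i < K) \sum_g (badg g * #|[pred y | r (g i) y]|) <=
   K.+1 * (K * (2 ^ K * total n K (fun s => ~~ grid_good n l s))).
  rewrite leq_mul2l /=.
  have -> : K * (2 ^ K * total n K (fun s => ~~ grid_good n l s)) =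
      \sum_(i < K) \sum_(g : {ffun 'I_K -> 'I_(2 * n)}) badg g.
    rewrite sum_nat_const card_ord; congr (_ * _); apply: esym.
    exact: (sum_halve (fun h => bad (cells h) : nat)).
  apply: leq_sum => i _; apply: leq_sum => g _.
  by rewrite card_touching; case: badg; case: (_ && _).
suff H : (1 * \sum_(f : {ffun 'I_K.+1 -> 'I_(2 * n)}) refined_only (cells f) <=
    K.+1 * \sum_i \sum_g (phi i g * #|[pred y | r (g i) y]|)
    + 1 * (K.+1 * \sum_(i < K) \sum_g (badg g * #|[pred y | r (g i) y]|))) /\
  (K.+1 * \sum_i \sum_g (phi i g * #|[pred y | r (g i) y]|) <=
    1 * (\sum_(f : {ffun 'I_K.+1 -> 'I_(2 * n)}) refined_only (cells f))
    + 1 * (K.+1 * \sum_(i < K) \sum_g (badg g * #|[pred y | r (g i) y]|))).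
  case: H => le1 le2; rewrite mainE; move: le1 le2 errL; rewrite !mul1n /total.
  set x := \sum_f _; set y := K.+1 * _; set z := K.+1 * _; set u := K.+1 * _.
  by clearbody x y z u; lia.
rewrite -(sum_related r phi) -(sum_related r (fun=> badg)).
apply: (@pair_expansion K _ (fun f => refined_only (cells f)) r 1 phi badg) => //.
  move=> f /andP[sc nsc].
  have [b [bn kb /mem_cells[i fi] /mem_cells[j fj]]] := odd_window_ends l_gt0 sc nsc.
  apply: (@ffun_lift_related _ _ f r i j); last by rewrite /r /touching -fi -fj; lia.
  by apply/eqP => ij; move: fi fj; rewrite ij => <-; lia.
move=> f j i rji; rewrite /badg /bad negbK cells_halve => good.
have pf := cells_perm_remove j f.
set g := ffremove j f in good pf *.
have gi : f (lift j i) = g i by rewrite ffunE.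
have symA : refined_only (cells f) = refined_only (nat_of_ord (f j) :: cells g).
  by rewrite /refined_only (grid_scan_ge_sym _ _ _ pf)
       (grid_scan_ge_sym _ _ _ (perm_map half pf)).
rewrite mul1n symA /refined_only (@critical_criterion n l k (cells g) (g i) (f j)) //; last first.
- by rewrite -gi.
- by apply/mem_cells; exists i.
- by move=> z /cells_lt.
rewrite (bigD1 j) //= (bigD1 i) //= rji -/g /phi cells_halve ffunE /=.
(* (j, i) is the only touching pair: coarse cells of g never differ by l, and
   the parity of the fine cells fixes which member of a pair is which. *)
have gnotl x y : x \in cells g -> y \in cells g -> ~~ touching l x y.
  move=> xg yg; apply/negP => /and3P[_ _ /eqP e].
  have := grid_good_diff good (mem_half xg); rewrite -e.
  by rewrite mem_half.
rewrite big1 ?addn0 => [|i' i'i]; last first.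
  case: (boolP (r _ _)) => // r'; case/eqP: i'i.
  have hi : injective (halve g) by apply/cells_uniqP; rewrite cells_halve; case/and3P: good.
  apply: hi; apply: val_inj; rewrite !ffunE /=.
  by move: rji r'; rewrite /r /touching; lia.
rewrite big1 => [|j' j'j].
  by rewrite addn0 ffunE /= gi.
apply: big1 => i' _.
case: (boolP (r _ _)) => // r'.
have fg x : x != j -> exists2 y, f x = g y & true.
  by case: (unliftP j x) => [y ->|->]; rewrite ?eqxx // => _; exists y; rewrite ?ffunE.
have [y' fy' _] := fg _ j'j.
have [e|] := eqVneq (lift j' i') j.
  by move: rji r'; rewrite e /r /touching; lia.
case/fg => x' fx' _.
have /negP[] : ~~ touching l (g x') (g y').
  by apply: gnotl; apply/mem_cells; [exists x'|exists y'].
by rewrite -fx' -fy'.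
Qed.

End Refinement.

(** * Multinomial counts and distinct cells *)

Definition occupancy n N (f : {ffun 'I_N -> 'I_n}) : {ffun 'I_n -> nat} :=
  [ffun i : 'I_n => count_mem (nat_of_ord i) (cells f)].

Lemma sum_count_mem n (s : seq nat) : {in s, forall x, x < n} ->
  \sum_(i < n) count_mem (nat_of_ord i) s = size s.
Proof.
elim: s => [|x s IH] sn; first by rewrite big1.
rewrite big_split /= IH => [|y ys]; last by apply: sn; rewrite inE ys orbT.
have xn : x < n by apply: sn; rewrite mem_head.
rewrite (bigD1 (Ordinal xn)) //= eqxx big1 ?addn0 // => i.
by rewrite -val_eqE /= eq_sym => /negPf->.
Qed.

Lemma sum_occupancy n N (f : {ffun 'I_N -> 'I_n}) : \sum_i occupancy f i = N.
Proof.
under eq_bigr do rewrite ffunE.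
by rewrite sum_count_mem ?size_cells // => x /cells_lt.
Qed.

Lemma occupancy_insert n N (y : 'I_n) (g : {ffun 'I_N -> 'I_n}) i :
  occupancy (ffinsert ord0 y g) i = (y == i) + occupancy g i.
Proof.
rewrite !ffunE ((permP (cells_perm_remove ord0 _)) _) /=.
by rewrite ffinsertK ffinsert_at.
Qed.

(** Recursion on the cell y of the first point: lowering c y by one divides the
    product of the factorials by c y, and the c y sum up to N + 1. *)
Lemma multinomial_count n N (c : {ffun 'I_n -> nat}) : \sum_i c i = N ->
  #|[pred f : {ffun 'I_N -> 'I_n} | occupancy f == c]| * \prod_i (c i)`! = N`!.
Proof.
rewrite -sum_bool_card.
elim: N c => [|N IH] c cN.
  have c0 i : c i = 0 by apply/eqP; rewrite -leqn0 -cN (bigD1 i) //= leq_addr.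
  rewrite [X in _ * X]big1 ?muln1 => [|i _]; last by rewrite c0.
  rewrite (eq_bigr (fun=> 1)) => [|f _].
    by rewrite sum_nat_const card_ffun !card_ord expn0.
  apply/eqP; rewrite eqb1; apply/eqP/ffunP => i; rewrite !ffunE c0.
  by rewrite (size0nil (size_cells f)).
transitivity ((\sum_i c i) * N`!); last by rewrite cN factS.
rewrite (sum_ffun_split ord0) exchange_big /= !big_distrl /=.
apply: eq_bigr => y _.
have [cy0|cy0] := posnP (c y).
  rewrite cy0 mul0n big1 // => g _; apply/eqP; rewrite eqb0.
  by apply/eqP => /ffunP/(_ y); rewrite occupancy_insert eqxx cy0.
pose c' := [ffun i => c i - (y == i)].
have cE i : c i = (y == i) + c' i.
  by rewrite ffunE; case: eqP => [<-|_] /=; lia.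
have c'N : \sum_i c' i = N.
  apply/eqP; rewrite -eqSS -cN [eqbRHS](eq_bigr (fun i => (y == i) + c' i)) => [|i _];
    last exact: cE.
  rewrite big_split /= sum_bool_card.
  by have -> : #|[eta eq_op y]| = 1 by rewrite -(card1 y); apply: eq_card => i;
    rewrite !inE eq_sym.
rewrite -(IH _ c'N) (bigD1 y) //= [in RHS](bigD1 y) //=.
have -> : (c y)`! = c y * (c' y)`! by rewrite cE eqxx add1n factS.
rewrite (eq_bigr (fun i => (c' i)`!)) => [|i]; last by rewrite [c i]cE eq_sym => /negPf->.
rewrite (eq_bigr (fun g => (occupancy g == c') : nat)) => [|g _];
  first by rewrite !mulnA [_ * c y]mulnC.
congr nat_of_bool; apply/eqP/eqP => [/ffunP e|e]; apply/ffunP => i.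
  by apply/eqP; rewrite -(eqn_add2l (y == i)) -cE -e occupancy_insert.
by rewrite occupancy_insert e -cE.
Qed.

Section DiscreteScan.
Variables (n N : nat).
Let J2 := {ffun 'I_n -> bool}.

Definition ones (J : J2) : seq nat := [seq nat_of_ord i | i <- enum [pred i | J i]].

Lemma mem_ones (J : J2) (i : 'I_n) : (nat_of_ord i \in ones J) = J i.
Proof. by rewrite mem_map ?mem_enum //; apply: val_inj. Qed.

Lemma uniq_ones (J : J2) : uniq (ones J).
Proof. by rewrite map_inj_uniq ?enum_uniq //; apply: val_inj. Qed.

Lemma ones_lt (J : J2) : {in ones J, forall x, x < n}.
Proof. by move=> x /mapP[i _ ->]. Qed.

(** A choice of distinct cells is a 0-1 vector with one of the N! orders on its
    ones: this is the multinomial count of a vector with entries 0 and 1. *)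
Lemma total_uniq (U : pred (seq nat)) : symmetric_stat U ->
  total n N (fun s => uniq s && U s) =
  N`! * #|[pred J : J2 | (\sum_r J r == N) && U (ones J)]|.
Proof.
move=> symU; pose nb (J : J2) : {ffun 'I_n -> nat} := [ffun i => J i : nat].
have one (f : {ffun 'I_N -> 'I_n}) : uniq (cells f) && U (cells f) =
    \sum_(J : J2) ((occupancy f == nb J) && U (ones J)) :> nat.
  have [uf|nuf] := boolP (uniq _); last first.
    rewrite big1 // => J _; apply/eqP; rewrite eqb0 negb_and; apply/orP; left.
    apply: contraNneq nuf => /ffunP e; apply: count_mem_uniq => x.
    have [xf|xf] := boolP (x \in cells f); last exact/count_memPn.
    have := e (Ordinal (cells_lt xf)); rewrite !ffunE /= => cx.
    by apply/eqP; rewrite eqn_leq -has_count has_pred1 xf cx leq_b1.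
  pose J0 : J2 := [ffun i : 'I_n => nat_of_ord i \in cells f].
  have occ0 J : (occupancy f == nb J) = (J == J0).
    apply/eqP/eqP => [/ffunP e|->]; apply/ffunP => i.
      by have := e i; rewrite !ffunE count_uniq_mem //; case: (_ \in _); case: (J i).
    by rewrite !ffunE count_uniq_mem.
  rewrite (bigD1 J0) //= occ0 eqxx /= big1 ?addn0 => [|J JJ0]; last first.
    by rewrite occ0 (negPf JJ0).
  congr nat_of_bool; apply: symU; apply: uniq_perm => //; first exact: uniq_ones.
  move=> x; have [xn|xn] := ltnP x n.
    by rewrite -[x]/(nat_of_ord (Ordinal xn)) mem_ones ffunE.
  transitivity false; first by apply/negP => /cells_lt; lia.
  by apply/esym/negP => /ones_lt; lia.
rewrite /total (eq_bigr _ (fun f _ => one f)) exchange_big /= -sum_bool_card big_distrr /=.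
apply: eq_bigr => J _.
have [UJ|] := boolP (U _); last first.
  by move=> _; rewrite andbF muln0 big1 // => f _; rewrite andbF.
rewrite andbT (eq_bigr (fun f => (occupancy f == nb J) : nat)) => [|f _]; last by rewrite andbT.
rewrite sum_bool_card.
have [JN|JN] := eqVneq (\sum_r J r) N.
  rewrite muln1 -(multinomial_count (c := nb J)).
    by rewrite [X in _ * X]big1 ?muln1 // => i _; rewrite ffunE; case: (J i).
  by rewrite -[RHS]JN; apply: eq_bigr => i _; rewrite ffunE.
rewrite muln0; apply: eq_card0 => f; rewrite inE; apply: contraNF JN => /eqP e.
by rewrite -(sum_occupancy f) e; apply/eqP; apply: eq_bigr => i _; rewrite ffunE.
Qed.

Lemma window_count_ones l (J : J2) b : window_count l (ones J) b
  = \sum_(r < n | b <= r < b + l) J r.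
Proof.
rewrite /window_count count_map -sum_bool_count big_enum_cond /= big_mkcond [RHS]big_mkcond /=.
apply: eq_bigr => i _; rewrite unfold_in /= andbT.
by case: (J i); case: (_ && _).
Qed.

Lemma discrete_scan_ge l k (J : J2) : 0 < k ->
  (k <= discrete_scan l J) = grid_scan_ge n l k (ones J).
Proof.
move=> k0; apply/idP/grid_scanP => [|[b bn kb]].
  rewrite /discrete_scan; elim/big_ind: _ => [|x y IHx IHy|i _ kx]; first lia.
    by rewrite leq_max => /orP[].
  by exists i; rewrite ?window_count_ones // -ltnS.
apply: leq_trans kb _; rewrite window_count_ones.
exact: (leq_bigmax (Ordinal (_ : b < (n - l).+1))).
Qed.

End DiscreteScan.

Local Open Scope ring_scope.

Lemma gamma_discreteE (R : realType) N n l k : (0 < k)%N ->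
  gamma_discrete R N n l k =
  (total n N (fun s => uniq s && grid_scan_ge n l k s))%:R / (total n N uniq)%:R.
Proof.
move=> k0; rewrite (total_uniq n N (@grid_scan_ge_sym n l k)).
have -> : total n N uniq = total n N (fun s => uniq s && true).
  by apply: eq_bigr => f _; rewrite andbT.
rewrite (@total_uniq n N (fun=> true)) // /gamma_discrete.
rewrite !cardsE !natrM -mulf_div divff ?mul1r ?pnatr_eq0 -?lt0n ?fact_gt0 //.
congr (_%:R / _%:R); apply: eq_card => J; rewrite !inE ?andbT //.
by rewrite unfold_in discrete_scan_ge.
Qed.

(** * Real points and their cells *)

Local Open Scope classical_set_scope.
Local Open Scope ring_scope.

Lemma npoints_itv (R : realType) (s : seq R) (a b : R) :
  npoints s `]a, b] = count (fun x => a < x <= b) s.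
Proof. by apply: eq_count => x; rewrite mem_setE in_itv. Qed.

Lemma npoints_cons (R : realType) (s : seq R) (x : R) (A : set R) :
  npoints (x :: s) A = ((x \in A) + npoints s A)%N.
Proof. by []. Qed.

Lemma scan_geP (R : realType) (w : R) (s : seq R) (k : nat) : w <= 1 ->
  reflect (exists2 t : R, 0 <= t <= 1 - w & (k <= npoints s `]t, (t + w)%R])%N)
          (k <= scan w s)%N.
Proof.
move=> w1; apply: (iffP idP) => [|[t t01 kt]].
  rewrite /scan; elim/big_ind: _ => [|x y IHx IHy|v /asboolP[t t01 <-] kx].
  - by rewrite leqn0 => /eqP ->; exists 0; rewrite // lexx subr_ge0.
  - by rewrite leq_max => /orP[].
  - by exists t.
apply: leq_trans kt _.
have lt : (npoints s `]t, (t + w)%R] < (size s).+1)%N by rewrite ltnS count_size.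
apply: (@leq_bigmax_cond _ _ (fun v : 'I_(size s).+1 => nat_of_ord v) (Ordinal lt)).
by apply/asboolP; exists t.
Qed.

Lemma scan_cons_le (R : realType) (w : R) (s : seq R) (x : R) : w <= 1 ->
  (scan w (x :: s) <= (scan w s).+1)%N.
Proof.
move=> w1; have /(scan_geP _ _ w1)[t t01 H] := leqnn (scan w (x :: s)).
apply: leq_trans H _; rewrite npoints_cons -add1n; apply: leq_add; first exact: leq_b1.
by apply/scan_geP => //; exists t.
Qed.

(** The cells ]c / n, (c + 1) / n] are closed on the right, as the windows are. *)
Definition cell (R : realType) (n : nat) (x : R) : nat :=
  (`|Num.ceil (n%:R * x)|%N).-1.

Section Cells.
Variables (R : realType) (n : nat).
Hypothesis n_gt0 : (0 < n)%N.

Lemma cell_lt (x : R) c : 0 < x -> (cell n x < c)%N = (n%:R * x <= c%:R).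
Proof.
move=> x0; have nx0 : 0 < n%:R * x by rewrite mulr_gt0 // ltr0n.
have c0 : 0 < Num.ceil (n%:R * x) by rewrite ltNge ceil_le_int -ltNge.
have := ceil_le_int (n%:R * x) c%:Z.
rewrite /cell -[c%:Z%:~R]/(c%:R : R) => <-.
move: c0. move: (Num.ceil (n%:R * x)) => [z|z] //; rewrite ltz_nat lez_nat /= => z0.
by rewrite prednK.
Qed.

Lemma cell_ge (x : R) c : 0 < x -> (c <= cell n x)%N = (c%:R < n%:R * x).
Proof. by move=> x0; rewrite leqNgt cell_lt // -ltNge. Qed.

Lemma cellP (x : R) : 0 < x -> (cell n x)%:R < n%:R * x <= (cell n x).+1%:R.
Proof. by move=> x0; rewrite -cell_ge // -cell_lt // ltnSn leqnn. Qed.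

End Cells.

Section Deterministic.
Variables (R : realType) (n l k : nat).
Hypotheses (l_gt0 : (0 < l)%N) (ln : (l < n)%N).
Let w : R := l%:R / n%:R.

Let n_gt0 : (0 < n)%N. Proof. exact: leq_ltn_trans ln. Qed.
Let nR0 : 0 < n%:R :> R. Proof. by rewrite ltr0n. Qed.
Let nw : n%:R * w = l%:R. Proof. by rewrite mulrC divfK ?gt_eqF. Qed.
Let w1 : w <= 1. Proof. by rewrite ler_pdivrMr // mul1r ler_nat ltnW. Qed.

Lemma npoints_scaled (s : seq R) t :
  npoints s `]t, (t + w)%R] =
  count (fun x => n%:R * t < n%:R * x <= n%:R * t + l%:R) s.
Proof.
rewrite npoints_itv; apply: eq_count => x.
by rewrite -nw -mulrDr ltr_pM2l // ler_pM2l.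
Qed.

Lemma scaled_onem t : (t <= 1 - w) = (n%:R * t <= (n - l)%:R).
Proof.
by rewrite -[LHS](ler_pM2l nR0) mulrBr mulr1 nw natrB // ltnW.
Qed.

Variable s : seq R.
Hypothesis s01 : {in s, forall x, 0 < x}.
Let cs := map (cell n) s.

Lemma npoints_grid b : npoints s `](b%:R / n%:R), (b%:R / n%:R + w)] = window_count l cs b.
Proof.
rewrite npoints_scaled mulrC divfK ?gt_eqF // /window_count count_map.
apply: eq_in_count => x xs /=.
by rewrite -natrD cell_ge ?cell_lt ?s01.
Qed.

(** A window starting in cell b meets the cells b, ..., b + l, the first and the
    last one only in part.  So it is dominated by the grid window b if cell b + l
    is empty, and by the grid window b + 1 if cell b is empty. *)
Lemma window_le_left b t : (b + l)%N \notin cs ->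
  b%:R <= n%:R * t <= b.+1%:R -> (npoints s `]t, (t + w)%R] <= window_count l cs b)%N.
Proof.
move=> nb /andP[bt tb]; rewrite npoints_scaled /window_count count_map.
apply: count_le_in => x xs /= /andP[tx xt].
have x0 := s01 xs.
have : (b <= cell n x)%N by rewrite cell_ge // (le_lt_trans bt).
have : (cell n x < b.+1 + l)%N.
  by rewrite cell_lt // natrD (le_trans xt) // lerD2r.
have : cell n x != (b + l)%N by apply: contraNneq nb => <-; apply: map_f.
by clear; lia.
Qed.

Lemma window_le_right b t : b \notin cs ->
  b%:R <= n%:R * t <= b.+1%:R -> (npoints s `]t, (t + w)%R] <= window_count l cs b.+1)%N.
Proof.
move=> nb /andP[bt tb]; rewrite npoints_scaled /window_count count_map.
apply: count_le_in => x xs /= /andP[tx xt].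
have x0 := s01 xs.
have : (b <= cell n x)%N by rewrite cell_ge // (le_lt_trans bt).
have : (cell n x < b.+1 + l)%N.
  by rewrite cell_lt // natrD (le_trans xt) // lerD2r.
have : cell n x != b by apply: contraNneq nb => <-; apply: map_f.
by clear; lia.
Qed.

Lemma grid_scan_le_scan : grid_scan_ge n l k cs -> (k <= scan w s)%N.
Proof.
case/grid_scanP => b bn kb; apply/scan_geP => //; exists (b%:R / n%:R).
  by rewrite divr_ge0 //= scaled_onem mulrC divfK ?gt_eqF // ler_nat.
by rewrite npoints_grid.
Qed.

(** When no two occupied cells differ by l, one of the two end cells of any
    window is empty. *)
Lemma scan_le_grid_scan : {in cs, forall x, (x + l)%N \notin cs} ->
  (k <= scan w s)%N -> grid_scan_ge n l k cs.
Proof.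
move=> nol /(scan_geP _ _ w1)[t /andP[t0 t1] kt]; apply/grid_scanP.
move: t0; rewrite le_eqVlt => /predU1P[t0|t0].
  exists 0%N => //; move: kt; rewrite -t0.
  by have := npoints_grid 0; rewrite mul0r => ->.
have /andP[bt tb] := cellP n_gt0 t0; set b := cell n t in bt tb.
have bn : (b < n - l)%N by rewrite cell_lt // -scaled_onem.
have [bcs|bcs] := boolP (b \in cs).
  exists b; first exact: ltnW.
  by apply: leq_trans kt _; apply: window_le_left (nol _ bcs) _; rewrite (ltW bt).
exists b.+1 => //.
by apply: leq_trans kt _; apply: window_le_right bcs _; rewrite (ltW bt).
Qed.

Hypothesis good : grid_good n l cs.

Let nol : {in cs, forall x, (x + l)%N \notin cs}.
Proof. by move=> x; apply: grid_good_diff good. Qed.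

Let nol2 x : x \in cs -> (x + l + l)%N \notin cs.
Proof. by case/and3P: good => _ /allP h _ /h /andP[]. Qed.

Let cell_inj : {in s &, injective (cell n)}.
Proof. by apply: uniq_map_inj; case/and3P: good. Qed.

Lemma scan_grid : (k <= scan w s)%N = grid_scan_ge n l k cs.
Proof. by apply/idP/idP; [apply: scan_le_grid_scan | apply: grid_scan_le_scan]. Qed.

Lemma npoints_after (Q : R) : Q \in s ->
  npoints s `]Q, (Q + w)] = count (fun x => cell n Q < x < cell n Q + l)%N cs.
Proof.
move=> Qs; have Q0 := s01 Qs; have /andP[Qa Qb] := cellP n_gt0 Q0.
have aQ : cell n Q \in cs by apply: map_f.
rewrite npoints_scaled count_map; apply: eq_in_count => x xs /=.
have x0 := s01 xs; have /andP[xa xb] := cellP n_gt0 x0.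
have xl : cell n x != (cell n Q + l)%N by apply: contraNneq (nol aQ) => <-; apply: map_f.
have [e|/eqP neq] := eqVneq (cell n x) (cell n Q).
  by rewrite (cell_inj xs Qs e) !ltxx ltnn.
apply/andP/andP => -[h1 h2].
  have xQ : (cell n Q <= cell n x)%N by rewrite cell_ge // (lt_trans Qa).
  have xQl : (cell n x < (cell n Q).+1 + l)%N.
    by rewrite cell_lt // natrD (le_trans h2) // lerD2r.
  by clear -xQ xQl xl neq; split; lia.
split.
  by apply: le_lt_trans Qb _; rewrite -cell_ge.
have : n%:R * x <= (cell n Q + l)%:R by rewrite -cell_lt.
by rewrite natrD => /le_trans; apply; rewrite lerD2r ltW.
Qed.

(** A window starting in [Q, Q + w] starts in one of the cells a, ..., a + l.  At
    the extreme cells general position keeps the dominating grid window within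
    the range a + 1, ..., a + l: Q is the only point of cell a and is not
    counted, and cell a + 2 l is empty. *)
Lemma windows_above (Q : R) : Q \in s ->
  (forall t : R, Q <= t <= Q + w -> (npoints s `]t, (t + w)%R] <= k - 2)%N) <->
  all (fun b => window_count l cs b <= k - 2)%N (iota (cell n Q).+1 l).
Proof.
move=> Qs; have Q0 := s01 Qs; have /andP[Qa Qb] := cellP n_gt0 Q0.
set a := cell n Q in Qa Qb *; have aQ : a \in cs by apply: map_f.
split => [H|/allP H t /andP[Qt tQ]].
  apply/allP => b; rewrite mem_iota => /andP[ab ba].
  rewrite -npoints_grid; apply: H.
  have bn : n%:R * (b%:R / n%:R) = b%:R :> R by rewrite mulrC divfK ?gt_eqF.
  rewrite -[X in X && _](ler_pM2l nR0) -[X in _ && X](ler_pM2l nR0) mulrDr nw bn.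
  rewrite (le_trans Qb) ?ler_nat //=.
  apply: le_trans (_ : (a + l)%:R <= _); first by rewrite ler_nat; clear -ba; lia.
  by rewrite natrD lerD2r ltW.
have {}H b : (a < b <= a + l)%N -> (window_count l cs b <= k - 2)%N.
  by move=> ab; apply: H; rewrite mem_iota; clear -ab; lia.
have t0 : 0 < t by apply: lt_le_trans Q0 Qt.
have /andP[bt tb] := cellP n_gt0 t0; set b := cell n t in bt tb.
have ab : (a <= b)%N by rewrite cell_ge // (lt_le_trans Qa) // ler_pM2l.
have bal : (b <= a + l)%N.
  rewrite -ltnS -addSn cell_lt // natrD.
  by apply: le_trans (_ : n%:R * (Q + w) <= _); rewrite ?ler_pM2l // mulrDr nw lerD2r.
have btb : b%:R <= n%:R * t <= b.+1%:R by rewrite (ltW bt).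
have [bl|bl] := boolP ((b + l)%N \in cs); last first.
  have [e|nab] := eqVneq b a; last first.
    by apply: leq_trans (window_le_left bl btb) _; apply: H; clear -ab bal nab; lia.
  apply: leq_trans (_ : window_count l cs a.+1 <= _)%N; last by apply: H; clear -l_gt0; lia.
  rewrite npoints_scaled /window_count count_map.
  apply: count_le_in => x xs /= /andP[tx xt].
  have x0 := s01 xs.
  have h1 : (a <= cell n x)%N by rewrite cell_ge // -e (lt_trans bt).
  have h2 : (cell n x < a.+1 + l)%N.
    by rewrite cell_lt // natrD (le_trans xt) // lerD2r -e.
  have h3 : cell n x != a.
    apply/eqP => /(cell_inj xs Qs) xQ; move: tx; rewrite xQ ltr_pM2l //.
    by rewrite ltNge Qt.
  by clear -h1 h2 h3; lia.
have bcs : b \notin cs by apply: contraL bl; apply: nol.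
have bneq : b != (a + l)%N by apply: contraTneq bl => ->; apply: nol2.
by apply: leq_trans (window_le_right bcs btb) _; apply: H; clear -ab bal bneq; lia.
Qed.

Lemma lt_onem_cell (Q : R) : Q \in s -> (Q < 1 - w) = (cell n Q < n - l)%N.
Proof.
move=> Qs; have Q0 := s01 Qs; have /andP[Qa Qb] := cellP n_gt0 Q0.
have aQ : cell n Q != (n - l).-1.
  by case/and3P: good => _ _; apply: contraNneq => <-; apply: map_f.
rewrite -[LHS](ltr_pM2l nR0) mulrBr mulr1 nw -(natrB _ (ltnW ln)).
apply/idP/idP => [Ql|al]; first by rewrite cell_lt // ltW.
by apply: le_lt_trans Qb _; rewrite ltr_nat; clear -al aQ; lia.
Qed.

Lemma nu_grid : nu w k s = grid_nu n l k cs.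
Proof.
rewrite /nu /grid_nu big_map big_mkcond [LHS]big_seq [RHS]big_seq.
apply: eq_bigr => Q Qs; rewrite lt_onem_cell // /grid_critical -scan_grid -ltnNge.
case: (_ < n - l)%N => //=; congr nat_of_bool; apply/asboolP/and3P.
  by case=> h1 h2 h3; split; rewrite // -?npoints_after ?h2 //; apply/windows_above.
by case=> h1 /eqP h2 h3; split; rewrite // ?npoints_after //; apply/windows_above.
Qed.

End Deterministic.

Section NuTilde.
Variables (R : realType) (n l k : nat).
Hypotheses (l_gt0 : (0 < l)%N) (ln : (l < n)%N).
Let w : R := l%:R / n%:R.

(** Doubling a point does not change the set of occupied cells, so the scan of
    the doubled configuration is also read on the grid. *)
Lemma nu_tilde_grid (s : seq R) : {in s, forall x, 0 < x} ->
  grid_good n l (map (cell n) s) ->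
  nu_tilde w k s = grid_nu_tilde n l k (map (cell n) s).
Proof.
move=> s0 good; rewrite /nu_tilde /grid_nu_tilde big_map [LHS]big_seq [RHS]big_seq.
have n0 : (0 < n)%N by apply: leq_ltn_trans ln.
have w1 : w <= 1 by rewrite ler_pdivrMr ?ltr0n // mul1r ler_nat ltnW.
apply: eq_bigr => Q Qs; congr nat_of_bool.
rewrite ltnNge (scan_grid k ln s0 good).
case: (boolP (grid_scan_ge n l k (map (cell n) s))) => //= nsc.
have sk : (scan w s < k)%N by rewrite ltnNge (scan_grid k ln s0 good).
rewrite eqn_leq (leq_trans (scan_cons_le s Q w1) sk) /=.
have Qs0 : {in Q :: s, forall x, 0 < x}.
  by move=> x; rewrite inE => /predU1P[->|]; apply: s0.
have aQ : cell n Q \in map (cell n) s by apply: map_f.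
have sub x : (x \in map (cell n) (Q :: s)) = (x \in map (cell n) s).
  by rewrite /= inE; case: eqP => // ->.
apply/idP/idP; last exact: (grid_scan_le_scan ln Qs0).
apply: (scan_le_grid_scan ln Qs0) => x; rewrite !sub; exact: grid_good_diff good.
Qed.

End NuTilde.

(** A window starting at t < 1 - w can be moved slightly to the right without
    losing a point, hence to a vertex of a fine enough grid; t = 1 - w is a
    vertex of every grid.  Thus the continuous scan event is a countable union of
    events about cells. *)
Lemma scan_some_grid (R : realType) (p q k : nat) (s : seq R) :
  (0 < p)%N -> (p < q)%N -> {in s, forall x, 0 < x} ->
  (k <= scan (p%:R / q%:R : R) s)%N ->
  exists2 m, (0 < m)%N & grid_scan_ge (m * q) (m * p) k (map (cell (m * q)) s).
Proof.
move=> p0 pq s0; set w : R := p%:R / q%:R => ks.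
have q0 : (0 < q)%N by apply: leq_ltn_trans pq.
have w1 : w <= 1 by rewrite ler_pdivrMr ?ltr0n // mul1r ler_nat ltnW.
have wE m : (0 < m)%N -> w = (m * p)%:R / (m * q)%:R.
  by move=> m0; rewrite !natrM -mulf_div divff ?mul1r // pnatr_eq0 -lt0n.
move/(scan_geP _ _ w1): ks => [t /andP[t0 t1] kt].
move: t1; rewrite le_eqVlt => /predU1P[tE|t1].
  exists 1%N => //; rewrite !mul1n; apply/grid_scanP; exists (q - p)%N => //.
  rewrite -(npoints_grid pq s0) (natrB _ (ltnW pq)) mulrBl divff ?pnatr_eq0 -?lt0n //.
  by rewrite -/w -tE.
have [d d0 sd] : exists2 d, 0 < d & {in s, forall x, t < x -> t + d < x}.
  elim: s s0 {kt} => [|x s IH] s0; first by exists 1.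
  have [|d d0 H] := IH; first by move=> y ys; apply: s0; rewrite inE ys orbT.
  have [tx|xt] := ltP t x; last first.
    exists d => // y; rewrite inE => /predU1P[->|]; last exact: H.
    by rewrite ltNge xt.
  exists (Num.min d ((x - t) / 2)); first by rewrite lt_min d0 divr_gt0 // subr_gt0.
  move=> y; rewrite inE => /predU1P[-> _|ys /(H _ ys)].
    have : Num.min d ((x - t) / 2) <= (x - t) / 2 by rewrite ge_min lexx orbT.
    by lra.
  have : Num.min d ((x - t) / 2) <= d by rewrite ge_min lexx.
  by lra.
(* A shift by at most e keeps all points and stays within [0, 1 - w]. *)
pose e := Num.min d (1 - w - t).
have e0 : 0 < e by rewrite lt_min d0 subr_gt0.
have [m m0 me] : exists2 m, (0 < m)%N & 1 <= (m * q)%:R * e.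
  exists (Num.truncn e^-1).+1 => //.
  rewrite -ler_pdivrMr // mul1r; apply: le_trans (ltW (truncnS_gt _)) _.
  by rewrite ler_nat leq_pmulr.
exists m => //; set n := (m * q)%N in me *; set l := (m * p)%N.
have n0 : (0 < n)%N by rewrite muln_gt0 m0.
have nR0 : 0 < n%:R :> R by rewrite ltr0n.
have ln : (l < n)%N by rewrite ltn_pmul2l.
pose b := (Num.truncn (n%:R * t)).+1.
have bt : n%:R * t < b%:R by apply: truncnS_gt.
have tb : b%:R <= n%:R * t + 1.
  by rewrite /b -natr1 lerD2r truncn_le // mulr_ge0 // ltW.
have ed : e <= d by rewrite ge_min lexx.
have ew : e <= 1 - w - t by rewrite ge_min lexx orbT.
have tbe : b%:R / n%:R <= t + e.
  by rewrite ler_pdivrMr // mulrC mulrDr (le_trans tb) // lerD2l.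
have btn : t <= b%:R / n%:R by rewrite ler_pdivlMr // mulrC ltW.
apply/grid_scanP; exists b.
  rewrite -(ler_nat R); have := @scaled_onem R n l ln (b%:R / n%:R).
  rewrite [n%:R * (_ / _)]mulrC divfK ?gt_eqF // => <-; rewrite -(wE m m0).
  by apply: le_trans tbe _; lra.
rewrite -(npoints_grid ln s0) -(wE m m0); apply: leq_trans kt _.
rewrite !npoints_itv; apply: count_le_in => x xs /= /andP[tx xt].
rewrite (le_lt_trans tbe) ?(le_trans xt) ?lerD2r //.
by have := sd x xs tx; move: ed; lra.
Qed.

(** * The cells of a Poisson process of given size *)

Definition mean (R : realType) (n N : nat) (F : seq nat -> nat) : R :=
  (total n N F)%:R / n%:R ^+ N.

Lemma perm_eq_bounded n (s1 s2 : seq nat) :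
  {in s1, forall a, (a < n)%N} -> {in s2, forall a, (a < n)%N} ->
  (forall i : 'I_n, count_mem (nat_of_ord i) s1 = count_mem (nat_of_ord i) s2) ->
  perm_eq s1 s2.
Proof.
move=> s1n s2n e; apply/allP => x _ /=; apply/eqP.
have [xn|xn] := ltnP x n; first exact: (e (Ordinal xn)).
have [/s1n|] := boolP (x \in s1); first by lia.
have [/s2n|] := boolP (x \in s2); first by lia.
by move=> /count_memPn -> /count_memPn ->.
Qed.

Lemma cells_surjective n (s : seq nat) : {in s, forall a, (a < n)%N} ->
  exists f : {ffun 'I_(size s) -> 'I_n}, cells f = s.
Proof.
move=> sn; have lt (i : 'I_(size s)) : (nth 0%N s i < n)%N by apply/sn/mem_nth.
exists [ffun i => Ordinal (lt i)]; rewrite -[RHS](mkseq_nth 0%N) /mkseq -val_enum_ord.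
by rewrite -map_comp; apply: eq_map => i /=; rewrite ffunE.
Qed.

Section Poisson.
Variables (R : realType) (lambda : R) (d : measure_display) (T : measurableType d).
Variables (P : probability T R) (Pi : T -> seq R).
Hypotheses (lambda_gt0 : 0 < lambda) (hPi : poisson_process P lambda Pi).

Let cells_of n om := map (cell n) (Pi om).

Lemma points_gt0 om : {in Pi om, forall x, 0 < x}.
Proof. by move=> x /(poisson_process_range hPi) /andP[]. Qed.

Lemma cells_of_lt n om : (0 < n)%N -> {in cells_of n om, forall a, (a < n)%N}.
Proof.
move=> n0 a /mapP[x xs ->]; have /andP[x0 x1] := poisson_process_range hPi xs.
by rewrite cell_lt // -[leRHS]mulr1 ler_pM2l // ltr0n.
Qed.

Definition cell_itv n (i : nat) : set R := `](i%:R / n%:R), (i.+1%:R / n%:R)].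

Lemma measurable_cell_itv n i : measurable (cell_itv n i).
Proof. exact: measurable_itv. Qed.

Lemma cell_itv_sub n (i : 'I_n) : cell_itv n i `<=` `]0, 1].
Proof.
have n0 : (0 : R) < n%:R by rewrite ltr0n (leq_ltn_trans _ (ltn_ord i)).
move=> x; rewrite /cell_itv /= !in_itv /= => /andP[ix xi];
  rewrite (le_lt_trans _ ix) ?divr_ge0 //=.
by rewrite (le_trans xi) // ler_pdivrMr // mul1r ler_nat.
Qed.

Lemma in_cell_itv n i x : (0 < n)%N -> 0 < x -> (x \in cell_itv n i) = (cell n x == i).
Proof.
move=> n0 x0; have nR : (0 : R) < n%:R by rewrite ltr0n.
rewrite /cell_itv mem_setE in_itv /= ltr_pdivrMr // ler_pdivlMr // mulrC.
by rewrite -cell_ge // -cell_lt // ltnS -eqn_leq eq_sym.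
Qed.

Lemma npoints_cell n i om : (0 < n)%N ->
  npoints (Pi om) (cell_itv n i) = count_mem i (cells_of n om).
Proof.
move=> n0; rewrite /npoints count_map; apply: eq_in_count => x /points_gt0 x0 /=.
exact: in_cell_itv.
Qed.

Lemma size_npoints om : npoints (Pi om) `]0, 1] = size (Pi om).
Proof.
apply/eqP; rewrite -all_count; apply/allP => x /(poisson_process_range hPi).
by rewrite mem_setE in_itv.
Qed.

Lemma measurable_npoints_eq (A : set R) j : measurable A ->
  measurable [set om | npoints (Pi om) A = j].
Proof.
move=> mA; have := poisson_process_measurable hPi mA measurableT (I : measurable [set j]).
by rewrite setTI.
Qed.

Lemma prob_npoints (A : set R) (v : R) j : measurable A -> A `<=` `]0, 1] ->
  lebesgue_measure A = v%:E -> 0 < v ->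
  P [set om | npoints (Pi om) A = j] =
  ((lambda * v) ^+ j / j`!%:R * expR (- (lambda * v)))%:E.
Proof.
move=> mA A01 Av v0.
rewrite (poisson_process_law hPi mA A01 [set j]) Av /= /poisson_prob mulr_gt0 //.
rewrite esum_set1; first by rewrite /poisson_pmf mulr_gt0.
by rewrite lee_fin poisson_pmf_ge0.
Qed.

Lemma prob_size N :
  P [set om | size (Pi om) = N] = (lambda ^+ N / N`!%:R * expR (- lambda))%:E.
Proof.
rewrite (_ : mkset _ = [set om | npoints (Pi om) `]0, 1] = N]); last first.
  by apply/seteqP; split => om /=; rewrite size_npoints.
rewrite (@prob_npoints _ 1) ?mulr1 //.
by rewrite lebesgue_measure_itv /= lte01 /= oppr0 adde0.
Qed.

Lemma prob_size_gt0 N : (0 < fine (P [set om | size (Pi om) = N])).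
Proof.
by rewrite prob_size /= !mulr_gt0 ?exprn_gt0 ?invr_gt0 ?ltr0n ?fact_gt0 ?expR_gt0.
Qed.

Lemma prob_occupancy n (c : 'I_n -> nat) : (0 < n)%N ->
  P [set om | forall i : 'I_n, npoints (Pi om) (cell_itv n i) = c i] =
  ((lambda / n%:R) ^+ (\sum_i c i) / (\prod_i (c i)`!)%:R * expR (- lambda))%:E.
Proof.
move=> n0; have nR : (0 : R) < n%:R by rewrite ltr0n.
rewrite (poisson_process_indep hPi (A := fun i : 'I_n => cell_itv n i)).
- rewrite (eq_bigr (fun i => ((lambda * n%:R^-1) ^+ c i / (c i)`!%:R *
      expR (- (lambda * n%:R^-1)))%:E)) => [|i _]; last first.
    apply: prob_npoints; rewrite ?invr_gt0 //.
    + exact: measurable_cell_itv.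
    + exact: cell_itv_sub.
    rewrite lebesgue_measure_itv /= lte_fin ltr_pM2r ?invr_gt0 // ltr_nat ltnSn.
    by rewrite -EFinD -mulrBl -natrB // subSnn mul1r.
  rewrite prodEFin; congr EFin; rewrite !big_split /= prodfV -natr_prod prodrXr.
  rewrite prodr_const card_ord -expRM_natl mulrN mulrCA divff ?gt_eqF // mulr1.
  by [].
- by move=> i; apply: measurable_cell_itv.
- exact: cell_itv_sub.
- apply/trivIsetP => i j _ _ ij; rewrite -subset0 => x [xi xj].
  have x0 : 0 < x by have := cell_itv_sub xi; rewrite /= in_itv => /andP[].
  move: (mem_set xi) (mem_set xj); rewrite !in_cell_itv // => /eqP -> /eqP e.
  by case/eqP: ij; apply: val_inj.
Qed.

Lemma measurable_occupancy n (c : 'I_n -> nat) :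
  measurable [set om | forall i : 'I_n, npoints (Pi om) (cell_itv n i) = c i].
Proof.
rewrite (_ : mkset _ = \bigcap_(i in [set: 'I_n]) [set om | npoints (Pi om) (cell_itv n i)
  = c i]).
  apply: fin_bigcap_measurable => // i _.
  by apply: measurable_npoints_eq; apply: measurable_cell_itv.
by apply/seteqP; split => om /= H i; [move=> _|]; apply: H.
Qed.

(** Given the total N, an occupancy vector c has probability proportional to the
    inverse of the product of the factorials of its entries, and so has the
    number of maps from 'I_N to 'I_n with these occupancies. *)
Lemma prob_grid_event n N (U : pred (seq nat)) : (0 < n)%N -> symmetric_stat U ->
  measurable [set om | U (cells_of n om) /\ size (Pi om) = N] /\
  P [set om | U (cells_of n om) /\ size (Pi om) = N] =
  (fine (P [set om | size (Pi om) = N]) * mean R n N U)%:E.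
Proof.
move=> n0 symU; have nR : (0 : R) < n%:R by rewrite ltr0n.
pose C := {ffun 'I_n -> 'I_N.+1}.
pose matches (c : C) (f : {ffun 'I_N -> 'I_n}) :=
  occupancy f == [ffun i : 'I_n => nat_of_ord (c i)].
pose W := [seq c <- enum C | [exists f, matches c f && U (cells f)]].
pose E (c : C) := [set om | forall i : 'I_n, npoints (Pi om) (cell_itv n i) = c i].
have WP c : reflect (exists2 f, matches c f & U (cells f)) (c \in W).
  rewrite mem_filter mem_enum andbT.
  apply: (iffP existsP) => [ [f /andP[mf Uf] ] | [f mf Uf] ]; exists f => //.
  exact/andP.
(* A disjoint union over the finitely many occupancy vectors of maps in U. *)
have UE : [set om | U (cells_of n om) /\ size (Pi om) = N] = \bigcup_(c in [set` W]) E c.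
  apply/seteqP; split => om.
    move=> [Uom sN]; have := @cells_surjective n (cells_of n om) (@cells_of_lt n om n0).
    rewrite size_map sN => -[f fE].
    have cE (i : 'I_n) : (inord (count_mem (nat_of_ord i) (cells_of n om)) : 'I_N.+1) =
        count_mem (nat_of_ord i) (cells_of n om) :> nat.
      by rewrite inordK // ltnS -sN -(size_map (cell n) (Pi om)) count_size.
    exists [ffun i : 'I_n => inord (count_mem (nat_of_ord i) (cells_of n om))].
      apply/WP; exists f; last by rewrite fE.
      by apply/eqP/ffunP => i; rewrite !ffunE cE fE.
    by move=> i; rewrite npoints_cell // ffunE cE.
  move=> [c /= /WP[f /eqP/ffunP fc Uf] omE].
  have pf : perm_eq (cells_of n om) (cells f).
    apply: (@perm_eq_bounded n) => [|a /cells_lt //|i]; first exact: cells_of_lt.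
    by rewrite -npoints_cell // omE; have := fc i; rewrite !ffunE => ->.
  split; first by rewrite (symU _ _ pf).
  by rewrite -(size_map (cell n)) (perm_size pf) size_cells.
have uW : uniq W by rewrite filter_uniq // enum_uniq.
have mE c : measurable (E c) by apply: measurable_occupancy.
split.
  by rewrite UE; apply: fin_bigcup_measurable => // c _.
rewrite UE measure_fin_bigcup //; last first.
  apply/trivIsetP => c1 c2 _ _ c12; rewrite -subset0 => om [h1 h2].
  case/eqP: c12; apply/ffunP => i; apply: val_inj => /=.
  by rewrite -(h1 i) (h2 i).
rewrite -fsbig_seq //.
pose K : R := (lambda / n%:R) ^+ N / N`!%:R * expR (- lambda).
rewrite (eq_big_seq (fun c => (K * (#|[pred f | matches c f]|)%:R)%:E)) => [|c]; last first.
  move=> /WP[f /eqP mf _]; apply: etrans (prob_occupancy (fun i => nat_of_ord (c i)) n0) _.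
  have cN : (\sum_i c i)%N = N.
    by rewrite -[RHS](sum_occupancy f) mf; apply: eq_bigr => i _; rewrite ffunE.
  rewrite cN /K; congr EFin.
  have := multinomial_count (c := [ffun i : 'I_n => nat_of_ord (c i)]) (N := N).
  rewrite (eq_bigr (fun i => nat_of_ord (c i))) => [/(_ cN)|i _]; last by rewrite ffunE.
  rewrite (eq_bigr (fun i => (c i)`!)%N) => [<-|i _]; last by rewrite ffunE.
  have p0 : (\prod_i (c i)`!)%:R != 0 :> R.
    by rewrite pnatr_eq0 -lt0n prodn_gt0 // => i; rewrite fact_gt0.
  have f0 : (#|[pred f | matches c f]|)%:R != 0 :> R.
    by rewrite pnatr_eq0 -lt0n; apply/card_gt0P; exists f; rewrite inE /matches mf.
  rewrite natrM; field. by rewrite p0 f0.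
rewrite sumEFin -big_distrr /=; congr EFin.
rewrite prob_size /= /mean.
have -> : \sum_(c <- W) (#|[pred f | matches c f]|)%:R = (total n N U)%:R :> R.
  rewrite -natr_sum; congr (_%:R).
  rewrite big_filter big_enum_cond /= (eq_bigr (fun c => \sum_f (matches c f : nat))%N)
    => [|c _]; last first.
    by rewrite sum_bool_card.
  rewrite exchange_big /=; apply: eq_bigr => f _.
  pose c0 : C := [ffun i : 'I_n => inord (occupancy f i)].
  have c0E i : c0 i = occupancy f i :> nat.
    by rewrite ffunE inordK // ltnS -[leqRHS](sum_occupancy f) (bigD1 i) //= leq_addr.
  have mc c : matches c f = (c == c0).
    apply/eqP/eqP => [/ffunP e|->]; apply/ffunP => i.
      by have := e i; rewrite [RHS]ffunE -c0E => /esym; apply: val_inj.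
    by rewrite [RHS]ffunE c0E.
  under eq_bigr do rewrite mc.
  rewrite big_mkcond (bigD1 c0) //= eqxx big1 ?addn0 => [|c /negPf ->]; last by case: ifP.
  case: existsP => [[g /andP[mg Ug]]|no].
    congr nat_of_bool; rewrite -(symU (cells g)) ?Ug //.
    apply: (@perm_eq_bounded n) => [a /cells_lt //|a /cells_lt //|i].
    move/eqP/ffunP/(_ i): mg; rewrite [RHS]ffunE c0E /occupancy !ffunE.
    by move=> ->.
  apply/esym/eqP; rewrite eqb0; apply/negP => Uf; apply: no; exists f.
  by rewrite mc eqxx.
rewrite /K expr_div_n; field.
by rewrite !gt_eqF ?ltr0n ?fact_gt0 // exprn_gt0.
Qed.

End Poisson.

(** * Conditional expectations between grid means *)

(** The integral of a nonnegative function, measurable or not, is a supremum over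
    the simple functions below it. *)
Lemma le_integral_ge0 d (T : measurableType d) (R : realType)
  (mu : {measure set T -> \bar R}) (f g : T -> \bar R) : (forall x, 0 <= f x)%E -> (forall x, f
    x <= g x)%E ->
  (\int[mu]_x f x <= \int[mu]_x g x)%E.
Proof.
move=> f0 fg; have g0 x : (0 <= g x)%E by apply: le_trans (fg x).
rewrite !ge0_integralTE //; apply: le_ereal_sup => _ [h hf <-].
by exists h => // x; apply: le_trans (fg x).
Qed.

Lemma eq_total n N (F G : seq nat -> nat) :
  (forall f : {ffun 'I_N -> 'I_n}, F (cells f) = G (cells f)) ->
  total n N F = total n N G.
Proof. by move=> FG; apply: eq_bigr => f _. Qed.

Lemma le_mean (R : realType) n N (F G : seq nat -> nat) :
  (forall f : {ffun 'I_N -> 'I_n}, (F (cells f) <= G (cells f))%N) ->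
  mean R n N F <= mean R n N G.
Proof.
by move=> FG; rewrite ler_wpM2r ?ler_nat ?total_le // invr_ge0 exprn_ge0.
Qed.

Lemma mean_ge0 (R : realType) n N F : 0 <= mean R n N F.
Proof. by rewrite divr_ge0 ?exprn_ge0. Qed.

Lemma meanD (R : realType) n N (F G : seq nat -> nat) :
  mean R n N (fun s => F s + G s)%N = mean R n N F + mean R n N G.
Proof. by rewrite /mean /total big_split /= natrD mulrDl. Qed.

Lemma meanM (R : realType) n N (c : nat) (F : seq nat -> nat) :
  mean R n N (fun s => c * F s)%N = c%:R * mean R n N F.
Proof. by rewrite /mean /total -big_distrr /= natrM mulrA. Qed.

Lemma mean_sum (R : realType) n N (M : nat) (F : 'I_M -> seq nat -> nat) :
  mean R n N (fun s => \sum_v F v s)%N = \sum_v mean R n N (F v).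
Proof. by rewrite /mean /total exchange_big /= natr_sum mulr_suml. Qed.

Lemma sum_ord_lt M c : (c <= M)%N -> (\sum_(v < M) ((v < c) : nat) = c)%N.
Proof.
move=> /minn_idPr {2}<-; elim: M => [|M IH]; first by rewrite big_ord0 min0n.
by rewrite big_ord_recr /= IH; lia.
Qed.

Lemma int_sum_indic d (T : measurableType d) (R : realType)
    (mu : {measure set T -> \bar R}) (I : finType) (S : I -> set T) : (forall i, measurable (S
      i)) ->
  (\int[mu]_x (\sum_i \1_(S i) x : R)%:E = \sum_i mu (S i))%E.
Proof.
move=> mS; under eq_integral do rewrite -sumEFin.
rewrite ge0_integral_sum //.
- by apply: eq_bigr => i _; rewrite integral_indic // setIT.
- by move=> i; apply/measurable_EFinP; apply: measurable_indic.
Qed.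

Section Sandwich.
Variables (R : realType) (lambda : R) (d : measure_display) (T : measurableType d).
Variables (P : probability T R) (Pi : T -> seq R).
Hypotheses (lambda_gt0 : 0 < lambda) (hPi : poisson_process P lambda Pi).
Variables (p q : nat).
Hypotheses (p0 : (0 < p)%N) (pq : (p < q)%N).
Let w : R := p%:R / q%:R.
Variable m : nat.
Hypothesis m0 : (0 < m)%N.
Let n := (m * q)%N.
Let l := (m * p)%N.
Let n0 : (0 < n)%N. Proof. by rewrite muln_gt0 m0 (leq_ltn_trans _ pq). Qed.
Let l0 : (0 < l)%N. Proof. by rewrite muln_gt0 m0. Qed.
Let ln : (l < n)%N. Proof. by rewrite ltn_pmul2l. Qed.
Let wE : w = l%:R / n%:R.
Proof. by rewrite !natrM -mulf_div divff ?mul1r // pnatr_eq0 -lt0n. Qed.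

Let cs om := map (cell n) (Pi om).
Let B N := [set om | size (Pi om) = N].
Let bad s := ~~ grid_good n l s.

Let fineP_ge0 N : 0 < fine (P (B N)). Proof. exact: (prob_size_gt0 lambda_gt0 hPi). Qed.

Let bad_sym : symmetric_stat bad.
Proof. by move=> s1 s2 /(grid_good_sym n l); rewrite /bad => ->. Qed.

Lemma measurable_scan N k :
  measurable ([set om | (k <= scan w (Pi om))%N] `&` B N).
Proof.
rewrite (_ : _ `&` _ = \bigcup_j [set om |
    grid_scan_ge (j.+1 * q) (j.+1 * p) k (map (cell (j.+1 * q)) (Pi om)) /\
    size (Pi om) = N]).
  apply: bigcupT_measurable => j.
  apply: (proj1 (prob_grid_event lambda_gt0 hPi N _ _)).
    by rewrite muln_gt0 (leq_ltn_trans _ pq).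
  exact: grid_scan_ge_sym.
apply/seteqP; split => om.
  case=> /= ks sN; have [[//|j] _ sc] := scan_some_grid p0 pq (points_gt0 hPi (om := om)) ks.
  by exists j.
case=> j _ /= [sc sN]; split => //=.
have -> : w = (j.+1 * p)%:R / (j.+1 * q)%:R.
  by rewrite !natrM -mulf_div divff ?mul1r // pnatr_eq0.
apply: grid_scan_le_scan sc; first by rewrite ltn_pmul2l.
exact: (points_gt0 hPi (om := om)).
Qed.

(** Grid windows are windows, and in general position every window is dominated
    by a grid window. *)
Lemma gamma_sandwich N k :
  mean R n N (grid_scan_ge n l k) <= gamma P Pi w k N <=
  mean R n N (grid_scan_ge n l k) + mean R n N bad.
Proof.
have [mG PG] := prob_grid_event lambda_gt0 hPi N n0 (@grid_scan_ge_sym n l k).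
have [mBad PBad] := prob_grid_event lambda_gt0 hPi N n0 bad_sym.
rewrite /gamma /cond_prob -/(B N) in PG PBad *.
set A := _ `&` _; have mA : measurable A by apply: measurable_scan.
have Afin : P A \is a fin_num by apply: fin_num_measure.
rewrite ler_pdivlMr // ler_pdivrMr // -!lee_fin fineK //; apply/andP; split.
  rewrite mulrC -PG; apply: le_measure; rewrite ?inE // => om [sc sN]; split => //=.
  rewrite wE; apply: grid_scan_le_scan sc => //; exact: (points_gt0 hPi (om := om)).
rewrite mulrDl EFinD ![_ * fine _]mulrC -PG -PBad.
apply: le_trans (measureU2 _ _ _) => //.
apply: le_measure; rewrite ?inE //; first exact: measurableU.
move=> om [/= sc sN]; have [good|?] := boolP (grid_good n l (cs om)); last by right.
left; split => //=; move: sc; rewrite wE => sc.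
by rewrite -(scan_grid k ln (points_gt0 hPi (om := om)) good).
Qed.

(** On the event size = N, X lies between two sums of indicators of events about
    cells: the level sets of F among good configurations and, for the upper
    bound, M copies of the bad event besides. *)
Lemma cond_expectation_sandwich N (M : nat) (X : T -> nat) (F : seq nat -> nat) :
  symmetric_stat F ->
  (forall s, size s = N -> (F s <= M)%N) ->
  (forall om, size (Pi om) = N -> (X om <= M)%N) ->
  (forall om, grid_good n l (cs om) -> X om = F (cs om)) ->
  `|cond_expectation P (fun om => (X om)%:R) (B N) - mean R n N F| <=
   M%:R * mean R n N bad.
Proof.
move=> symF FM XM XF.
pose G (v : nat) s := (v < F s)%N && grid_good n l s.
have symG v : symmetric_stat (G v).
  by move=> s1 s2 s12; rewrite /G (symF _ _ s12) (grid_good_sym n l s12).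
pose SG v := [set om | G v (cs om) /\ size (Pi om) = N].
pose SB := [set om | bad (cs om) /\ size (Pi om) = N].
have [mB PB] := prob_grid_event lambda_gt0 hPi N n0 bad_sym.
have mG v : measurable (SG v) := (prob_grid_event lambda_gt0 hPi N n0 (symG v)).1.
have PG v := (prob_grid_event lambda_gt0 hPi N n0 (symG v)).2.
rewrite -/SB in mB PB.
pose b := fine (P (B N)).
pose g (om : T) : bool := (size (Pi om) == N) && grid_good n l (cs om).
pose S (v : 'I_M + 'I_M) := if v is inl v then SG v else SB.
have mS v : measurable (S v) by case: v => [v|v]; [exact: mG | exact: mB].
have SGE v om : \1_(SG v) om = (g om && (v < F (cs om))%N)%:R :> R.
  rewrite indicE; congr (nat_of_bool _)%:R; apply/idP/idP; rewrite inE.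
    by case=> /andP[vF good] sN; rewrite /g sN eqxx good.
  by case/andP=> /andP[/eqP sN good] vF; split => //; apply/andP.
have SBE om : \1_SB om = ((size (Pi om) == N) && bad (cs om))%:R :> R.
  rewrite indicE; congr (nat_of_bool _)%:R; apply/idP/idP; rewrite inE.
    by case=> -> ->; rewrite eqxx.
  by case/andP=> /eqP sN good.
(* The sums of indicators below and above X on the event size = N. *)
pose low om : R := \sum_(v < M) \1_(SG v) om.
pose high om : R := \sum_v \1_(S v) om.
have FM' om : g om -> (F (cs om) <= M)%N.
  by case/andP => /eqP sN _; apply: FM; rewrite size_map.
have lowE om : low om = (g om * F (cs om))%:R.
  rewrite /low; under eq_bigr do rewrite SGE.
  rewrite -natr_sum; congr (_%:R); case: (boolP (g om)) => [gom|_] /=.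
    by rewrite mul1n sum_ord_lt // FM'.
  by rewrite big1.
have highE om : high om = low om + M%:R * ((size (Pi om) == N) && bad (cs om))%:R.
  rewrite /high big_sumType /=; congr (_ + _).
  by under eq_bigr do rewrite SBE; rewrite sumr_const card_ord mulr_natl.
have b0 : 0 < b by apply: fineP_ge0.
pose mF := mean R n N (fun s => \sum_(v < M) G v s)%N.
have intlow : (\int[P]_om (low om)%:E = (b * mF)%:E)%E.
  rewrite int_sum_indic //.
  rewrite (eq_bigr (fun v : 'I_M => (b * mean R n N (G v))%:E)) => [|v _]; last exact: PG.
  by rewrite sumEFin -mulr_sumr /mF mean_sum.
have inthigh : (\int[P]_om (high om)%:E = (b * (mF + M%:R * mean R n N bad))%:E)%E.
  rewrite int_sum_indic // big_sumType /=.
  rewrite (eq_bigr (fun v : 'I_M => (b * mean R n N (G v))%:E)) => [|v _]; last exact: PG.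
  rewrite [X in (_ + X)%E](eq_bigr (fun v : 'I_M => (b * mean R n N bad)%:E)) => [|v _];
    last exact: PB.
  rewrite !sumEFin -EFinD -mulr_sumr -mean_sum sumr_const card_ord mulrDr.
  by rewrite -mulrnAr mulr_natl.
have mFle : mF <= mean R n N F <= mF + M%:R * mean R n N bad.
  have GE s : size s = N -> (\sum_(v < M) G v s = grid_good n l s * F s)%N.
    move=> sN; rewrite /G; case: grid_good.
      by rewrite mul1n -[RHS](@sum_ord_lt M) ?FM //; apply: eq_bigr => v _; rewrite andbT.
    by rewrite big1 // => v _; rewrite andbF.
  rewrite -meanM -meanD; apply/andP; split; apply: le_mean => f.
    by rewrite GE ?size_cells //; case: grid_good; rewrite // mul1n.
  rewrite GE ?size_cells // /bad; case: grid_good; rewrite ?mul1n ?leq_addr //=.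
  by rewrite muln1 FM ?size_cells.
pose Y om : R := (X om)%:R * \1_(B N) om.
have BE om : \1_(B N) om = (size (Pi om) == N)%:R :> R.
  by rewrite indicE; congr (nat_of_bool _)%:R; apply/idP/idP; rewrite inE => /eqP.
have lowY om : low om <= Y om.
  rewrite lowE /Y BE /g; case: eqP => sN; rewrite ?mulr0 //= mulr1 ler_nat.
  by have [good|] := boolP (grid_good _ _ _); rewrite // mul1n -XF.
have Yhigh om : Y om <= high om.
  rewrite highE lowE /Y BE /g; case: eqP => sN; rewrite ?mulr0 ?addr0 //= !mulr1.
  rewrite /bad; have [good|] := boolP (grid_good _ _ _).
    by rewrite mul1n -XF //= mulr0 addr0.
  by rewrite mul0n add0r /= mulr1 ler_nat XM.
have low0 om : 0 <= low om by rewrite lowE.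
have E1 : ((b * mF)%:E <= \int[P]_om (Y om)%:E)%E.
  by rewrite -intlow; apply: le_integral_ge0 => om; rewrite lee_fin.
have E2 : (\int[P]_om (Y om)%:E <= (b * (mF + M%:R * mean R n N bad))%:E)%E.
  rewrite -inthigh; apply: le_integral_ge0 => om; rewrite lee_fin //.
  exact: le_trans (low0 om) (lowY om).
have -> : cond_expectation P (fun om => (X om)%:R) (B N) = fine (\int[P]_om (Y om)%:E)%E / b.
  by rewrite /cond_expectation unlock.
move: E1 E2; case: (\int[P]_om (Y om)%:E)%E => [y|//|//]; rewrite !lee_fin /= => E1 E2.
have : mF <= y / b <= mF + M%:R * mean R n N bad.
  by rewrite ler_pdivlMr // ler_pdivrMr // ![_ * b]mulrC E1.
by move: mFle => /andP[h1 h2] /andP[h3 h4]; rewrite ler_norml; lra.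
Qed.

End Sandwich.

(** * Limits of sequences *)

Lemma cvg_close (R : realType) (u v b : nat -> R) (L : R) :
  (forall m, (0 < m)%N -> `|u m - v m| <= b m) ->
  b @ \oo --> (0 : R) -> v @ \oo --> L -> u @ \oo --> L.
Proof.
move=> uvb b0 vL.
have uv0 : (fun m => u m - v m) @ \oo --> (0 : R).
  apply/cvgrPdist_le => e e0; move/cvgrPdist_le: b0 => /(_ e e0) H.
  near=> m; rewrite sub0r normrN.
  apply: le_trans (uvb m _) _; first by near: m; exists 1%N.
  by rewrite (le_trans (ler_norm _)) // -[X in X <= _]normrN -sub0r; near: m.
rewrite (_ : u = (fun m => (u m - v m) + v m)); last first.
  by apply/funext => m; rewrite subrK.
by rewrite -[L]add0r; apply: cvgD.
Unshelve. all: by end_near. Qed.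

(** The increment from 2^r m to 2^(r+1) m is about L / (c m 2^r).  The increments
    telescope to g - a m, and the geometric series sums up to 2. *)
Lemma cvg_doubling (R : realType) (a : nat -> R) (c g L : R) : 0 < c ->
  a @ \oo --> g ->
  (fun m => c * m%:R * (a (2 * m)%N - a m)) @ \oo --> L ->
  (fun m => c * m%:R * (g - a m)) @ \oo --> 2 * L.
Proof.
move=> c0 ag uL; apply/cvgrPdist_le => e e0.
have e4 : 0 < e / 4 by lra.
move/cvgrPdist_le: uL => /(_ _ e4) [M _ HM].
exists (maxn M 1) => // m /= Mm.
have m0 : (0 < m)%N by lia.
have cm0 : 0 < c * m%:R by rewrite mulr_gt0 // ltr0n.
(* The partial sums of the telescoping series. *)
have step r : `|c * m%:R * (a (2 ^ r * m)%N - a m) - 2 * L * (1 - 2^-1 ^+ r)| <=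
    2 * (e / 4) * (1 - 2^-1 ^+ r).
  elim: r => [|r IH].
    by rewrite expr0 expn0 mul1n !subrr !mulr0 subr0 normr0.
  have := HM (2 ^ r * m)%N; rewrite /= => /(_ _)/wrap[].
    by rewrite (leq_trans _ (leq_pmull _ _)) ?expn_gt0 //; lia.
  set u := c * _ * _ => Hu.
  have uE : c * m%:R * (a (2 ^ r.+1 * m)%N - a (2 ^ r * m)%N) = u * 2^-1 ^+ r.
    rewrite /u expnS -mulnA natrM natrX exprVn; field.
    by rewrite expf_eq0 pnatr_eq0 andbF.
  have z0 : 0 <= 2^-1 ^+ r :> R by rewrite exprn_ge0.
  rewrite exprS; set z := 2^-1 ^+ r in IH uE z0 *.
  have {}Hu : `|(L - u) * z| <= e / 4 * z.
    by rewrite normrM (ger0_norm z0) ler_wpM2r.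
  rewrite (_ : c * m%:R * (a (2 ^ r.+1 * m)%N - a m) =
      c * m%:R * (a (2 ^ r * m)%N - a m) + u * z); last by rewrite -uE; ring.
  by move: IH Hu; rewrite !ler_norml => /andP[h1 h2] /andP[h3 h4]; lra.
have e4' : 0 < e / 4 / (c * m%:R) by rewrite divr_gt0.
move/cvgrPdist_le: ag => /(_ _ e4') [M1 _ HM1].
have z0 : (fun r => 2 * L * 2^-1 ^+ r) @ \oo --> (0 : R).
  by apply: (@cvg_geometric R (2 * L) 2^-1); rewrite ger0_norm ?invr_ge0 //; lra.
move/cvgrPdist_le: z0 => /(_ _ e4) [M2 _ HM2].
pose r := maxn M1 M2.
have := HM2 r (leq_maxr _ _); rewrite sub0r normrN => h2.
have := HM1 (2 ^ r * m)%N; rewrite /= => /(_ _)/wrap[].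
  apply: leq_trans (leq_maxl M1 M2) _; rewrite -/r.
  by apply: leq_trans (ltnW (@ltn_expl 2 r _)) _; rewrite ?leq_pmulr.
rewrite ler_pdivlMr // => h1.
have {}h1 : `|c * m%:R * (g - a (2 ^ r * m)%N)| <= e / 4.
  by rewrite normrM (gtr0_norm cm0) mulrC.
have z0 : 0 <= 2^-1 ^+ r :> R by rewrite exprn_ge0.
have := step r; set z := 2^-1 ^+ r in h2 z0 *.
rewrite (_ : c * m%:R * (g - a m) =
  c * m%:R * (g - a (2 ^ r * m)%N) + c * m%:R * (a (2 ^ r * m)%N - a m)); last by ring.
move: h1 h2; rewrite !ler_norml => /andP[h1 h1'] /andP[h2 h2'] /andP[h3 h3'].
have : 0 <= e * z by rewrite mulr_ge0 // ltW.
by lra.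
Qed.

(** * Expansions of grid means *)

Lemma dist_natr (R : realType) (a b e : nat) : (a <= b + e)%N -> (b <= a + e)%N ->
  `|a%:R - b%:R| <= e%:R :> R.
Proof. by rewrite -!(ler_nat R) !natrD ler_norml => h1 h2; lra. Qed.

Lemma mean_bad_le (R : realType) n l K : (0 < n)%N -> (0 < l)%N ->
  mean R n K (fun s => ~~ grid_good n l s) <= 4 * K%:R ^+ 2 / n%:R.
Proof.
move=> n0 l0; have nR : 0 < n%:R :> R by rewrite ltr0n.
rewrite /mean ler_pdivrMr ?exprn_gt0 // mulrAC ler_pdivlMr // mulrC.
by have := grid_bad_bound n K l0; rewrite -(ler_nat R) !natrM !natrX.
Qed.

(** The factor 1/4 is the probability that two points, placed in the coarse cells
    a and a + l, lie in the right half of the first and the left half of the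
    second. *)
Lemma mean_scan_refine (R : realType) n l k K : (0 < n)%N -> (0 < l)%N -> (2 <= k)%N ->
  `|n%:R * (mean R (2 * n) K.+1 (grid_scan_ge (2 * n) (2 * l) k)
            - mean R n K.+1 (grid_scan_ge n l k))
    - K.+1%:R / 4 * mean R n K (grid_nu n l k)| <=
  K.+1%:R * K%:R / 2 * mean R n K (fun s => ~~ grid_good n l s).
Proof.
move=> n0 l0 k2; have nR : 0 < n%:R :> R by rewrite ltr0n.
have [h1 h2] := refinement_expansion n K l0 k2.
have := dist_natr R h1 h2; rewrite /mean total_scan_refine // !natrM.
set D := total _ _ _; set A := total n K.+1 _; set V := total n K _; set Z := total n K _.
rewrite natrD natrM !natrX exprMn => H.
have nn : n%:R != 0 :> R by rewrite gt_eqF.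
have t0 : (2 ^+ K : R) != 0 by rewrite expf_eq0 pnatr_eq0 andbF.
have nK0 : n%:R ^+ K != 0 :> R by rewrite expf_eq0 negb_and nn orbT.
rewrite (_ : n%:R * _ - _ = (2 * D%:R - K.+1%:R * 2 ^+ K * V%:R) / (2 ^+ K * 4 * n%:R ^+ K)).
  rewrite normrM [X in _ * X]ger0_norm ?invr_ge0 ?mulr_ge0 ?exprn_ge0 //.
  rewrite [leRHS](_ : _ = (2 * (K.+1%:R * (K%:R * (2 ^+ K * Z%:R)))) / (2 ^+ K * 4 * n%:R ^+ K)).
    by rewrite ler_wpM2r // invr_ge0 ?mulr_ge0 ?exprn_ge0.
  by field; rewrite t0 nK0.
by rewrite !exprS; field; rewrite t0 nK0 nn.
Qed.

Lemma mean_coincidence (R : realType) n K (U : pred (seq nat)) : (0 < n)%N ->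
  symmetric_stat U ->
  `|n%:R * mean R n K.+1 (fun s => ~~ uniq s && U s)
    - K.+1%:R / 2 * mean R n K (fun s => \sum_(a <- s) U (a :: s))%N| <=
  K.+1%:R * K%:R * mean R n K (fun s => ~~ uniq s).
Proof.
move=> n0 symU; have nR : 0 < n%:R :> R by rewrite ltr0n.
have [h1 h2] := coincidence_expansion n K symU.
have := dist_natr R h1 h2; rewrite /mean !natrM.
set D := total _ _ _; set V := total n K _; set Z := total n K _.
move=> H.
have nn : n%:R != 0 :> R by rewrite gt_eqF.
have nK0 : n%:R ^+ K != 0 :> R by rewrite expf_eq0 negb_and nn orbT.
rewrite (_ : n%:R * _ - _ = (2 * D%:R - K.+1%:R * V%:R) / (2 * n%:R ^+ K)).
  rewrite normrM [X in _ * X]ger0_norm ?invr_ge0 ?mulr_ge0 ?exprn_ge0 //.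
  rewrite [leRHS](_ : _ = (2 * (K.+1%:R * (K%:R * Z%:R))) / (2 * n%:R ^+ K)).
    by rewrite ler_wpM2r // invr_ge0 ?mulr_ge0 ?exprn_ge0.
  by field; rewrite nK0.
by rewrite !exprS; field; rewrite nK0 nn.
Qed.

Lemma sum_double_scan n l k s :
  (\sum_(a <- s) grid_scan_ge n l k (a :: s) =
   size s * grid_scan_ge n l k s + grid_nu_tilde n l k s)%N.
Proof.
rewrite /grid_nu_tilde -sum1_size big_distrl -big_split /=; apply: eq_bigr => a _.
rewrite mul1n; case: (boolP (grid_scan_ge n l k s)) => //= /grid_scanP[b bn kb].
suff -> : grid_scan_ge n l k (a :: s) by [].
by apply/grid_scanP; exists b => //; apply: leq_trans kb _; apply: leq_addl.
Qed.

Lemma mean_1 (R : realType) n N : (0 < n)%N -> mean R n N (fun=> 1%N) = 1.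
Proof.
move=> n0; rewrite /mean /total sum_nat_const muln1 card_ffun !card_ord natrX divff //.
by rewrite expf_eq0 pnatr_eq0 (gtn_eqF n0) andbF.
Qed.

(** * Limits along the grids *)

Lemma grid_nu_le_size n l k s : (grid_nu n l k s <= size s)%N.
Proof. by rewrite -sum1_size; apply: leq_sum => a _; apply: leq_b1. Qed.

Lemma grid_nu_tilde_le_size n l k s : (grid_nu_tilde n l k s <= size s)%N.
Proof. by rewrite -sum1_size; apply: leq_sum => a _; apply: leq_b1. Qed.

Lemma nu_le_size (R : realType) (w : R) k s : (nu w k s <= size s)%N.
Proof.
rewrite -sum1_size /nu big_mkcond; apply: leq_sum => a _.
by case: ifP => // _; apply: leq_b1.
Qed.

Lemma nu_tilde_le_size (R : realType) (w : R) k s : (nu_tilde w k s <= size s)%N.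
Proof. by rewrite -sum1_size; apply: leq_sum => a _; apply: leq_b1. Qed.

Section Limits.
Variables (R : realType) (p q k : nat).
Hypotheses (p0 : (0 < p)%N) (pq : (p < q)%N) (k2 : (2 <= k)%N).
Variables (lambda : R) (d : measure_display) (T : measurableType d).
Variables (P : probability T R) (Pi : T -> seq R).
Hypotheses (lambda_gt0 : 0 < lambda) (hPi : poisson_process P lambda Pi).
Let w : R := p%:R / q%:R.
Let q0 : (0 < q)%N. Proof. exact: leq_ltn_trans pq. Qed.
Let cond J (X : seq R -> nat) : R :=
  cond_expectation P (fun om => (X (Pi om))%:R) [set om | size (Pi om) = J].

Definition scan_mean J m : R := mean R (m * q) J (grid_scan_ge (m * q) (m * p) k).
Definition bad_mean J m : R := mean R (m * q) J (fun s => ~~ grid_good (m * q) (m * p) s).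
Definition nu_mean J m : R := mean R (m * q) J (grid_nu (m * q) (m * p) k).
Definition nu_tilde_mean J m : R := mean R (m * q) J (grid_nu_tilde (m * q) (m * p) k).

Let err (c : R) (m : nat) : R := c * harmonic m.

Lemma cvg_err c : err c @ \oo --> (0 : R).
Proof. by rewrite -(mulr0 c); apply: cvgM; [exact: cvg_cst | exact: cvg_harmonic]. Qed.

Lemma bad_mean_le J m : (0 < m)%N -> bad_mean J m <= err (8 * J%:R ^+ 2) m.
Proof.
move=> m0; apply: le_trans (mean_bad_le R J _ _) _; rewrite ?muln_gt0 ?m0 //.
have mq : m.+1%:R <= 2 * (m * q)%:R :> R.
  by rewrite -natrM ler_nat; clear -m0 q0; nia.
have J0 : 0 <= J%:R ^+ 2 :> R by rewrite exprn_ge0.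
rewrite /err /harmonic /= ler_pdivrMr ?ltr0n ?muln_gt0 ?m0 //.
rewrite [leRHS]mulrAC ler_pdivlMr ?ltr0n //.
by have := ler_wpM2l J0 mq; lra.
Qed.

Lemma bad_mean_ge0 J m : 0 <= bad_mean J m. Proof. exact: mean_ge0. Qed.

Lemma cvg_scan_mean J : scan_mean J @ \oo --> gamma P Pi w k J.
Proof.
apply: (cvg_close (v := fun=> gamma P Pi w k J) (b := err (8 * J%:R ^+ 2))).
- move=> m m0; apply: le_trans (bad_mean_le J m0).
  have /andP[h1 h2] := gamma_sandwich lambda_gt0 hPi p0 pq m0 J k.
  by rewrite ler_norml /scan_mean /bad_mean; have := bad_mean_ge0 J m; rewrite /bad_mean; lra.
- exact: cvg_err.
- exact: cvg_cst.
Qed.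

Lemma cvg_cond J M (X : seq R -> nat) (F : nat -> seq nat -> nat) :
  (forall m, symmetric_stat (F m)) ->
  (forall m s, size s = J -> (F m s <= M)%N) ->
  (forall s, size s = J -> (X s <= M)%N) ->
  (forall m om, (0 < m)%N -> grid_good (m * q) (m * p) (map (cell (m * q)) (Pi om)) ->
     X (Pi om) = F m (map (cell (m * q)) (Pi om))) ->
  (fun m => mean R (m * q) J (F m)) @ \oo --> cond J X.
Proof.
move=> symF FM XM XF.
apply: (cvg_close (v := fun=> cond J X) (b := err (M%:R * (8 * J%:R ^+ 2)))).
- move=> m m0; rewrite distrC.
  have := cond_expectation_sandwich lambda_gt0 hPi pq m0 (X := fun om => X (Pi om))
    (symF m) (FM m) (fun om => XM (Pi om)) (fun om => XF m om m0).
  move/le_trans; apply.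
  by rewrite /err -mulrA ler_wpM2l // bad_mean_le.
- exact: cvg_err.
- exact: cvg_cst.
Qed.

Let n_gt0 m : (0 < m)%N -> (0 < m * q)%N. Proof. by move=> m0; rewrite muln_gt0 m0. Qed.
Let l_gt0 m : (0 < m)%N -> (0 < m * p)%N. Proof. by move=> m0; rewrite muln_gt0 m0. Qed.
Let l_lt m : (0 < m)%N -> (m * p < m * q)%N. Proof. by move=> m0; rewrite ltn_pmul2l. Qed.
Let wE m : (0 < m)%N -> w = (m * p)%:R / (m * q)%:R.
Proof. by move=> m0; rewrite !natrM -mulf_div divff ?mul1r // pnatr_eq0 -lt0n. Qed.

Let nu_good m om : (0 < m)%N -> grid_good (m * q) (m * p) (map (cell (m * q)) (Pi om)) ->
  nu w k (Pi om) = grid_nu (m * q) (m * p) k (map (cell (m * q)) (Pi om)).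
Proof.
move=> m0; rewrite (wE m0); apply: nu_grid; rewrite ?l_gt0 ?l_lt //.
exact: (points_gt0 hPi (om := om)).
Qed.

Let nu_tilde_good m om : (0 < m)%N ->
  grid_good (m * q) (m * p) (map (cell (m * q)) (Pi om)) ->
  nu_tilde w k (Pi om) = grid_nu_tilde (m * q) (m * p) k (map (cell (m * q)) (Pi om)).
Proof.
move=> m0; rewrite (wE m0); apply: nu_tilde_grid; rewrite ?l_gt0 ?l_lt //.
exact: (points_gt0 hPi (om := om)).
Qed.

Lemma cvg_nu_mean J : nu_mean J @ \oo --> cond J (nu w k).
Proof.
apply: (@cvg_cond J J (nu w k) (fun m => grid_nu (m * q) (m * p) k)) => //.
- by move=> m; apply: grid_nu_sym.
- by move=> m s <-; apply: grid_nu_le_size.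
- by move=> s <-; apply: nu_le_size.
Qed.

Lemma cvg_nu_tilde_mean J : nu_tilde_mean J @ \oo --> cond J (nu_tilde w k).
Proof.
apply: (@cvg_cond J J (nu_tilde w k) (fun m => grid_nu_tilde (m * q) (m * p) k)) => //.
- by move=> m; apply: grid_nu_tilde_sym.
- by move=> m s <-; apply: grid_nu_tilde_le_size.
- by move=> s <-; apply: nu_tilde_le_size.
Qed.

(** Both sides are limits of the same grid means. *)
Lemma cond_nu_add J : cond J (fun s => nu w k s + nu_tilde w k s)%N =
  cond J (nu w k) + cond J (nu_tilde w k).
Proof.
pose F m s := (grid_nu (m * q) (m * p) k s + grid_nu_tilde (m * q) (m * p) k s)%N.
have sumF : (fun m => mean R (m * q) J (F m)) = nu_mean J \+ nu_tilde_mean J.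
  by apply/funext => m; rewrite meanD.
have lim1 : (fun m => mean R (m * q) J (F m)) @ \oo -->
    cond J (fun s => nu w k s + nu_tilde w k s)%N.
  apply: (@cvg_cond J (J + J)).
  - by move=> m s1 s2 s12; congr (_ + _)%N; [apply: grid_nu_sym | apply: grid_nu_tilde_sym].
  - by move=> m s <-; apply: leq_add; [apply: grid_nu_le_size | apply: grid_nu_tilde_le_size].
  - by move=> s <-; apply: leq_add; [apply: nu_le_size | apply: nu_tilde_le_size].
  - by move=> m om m0 good; rewrite (nu_good m0 good) (nu_tilde_good m0 good).
have lim2 : (fun m => mean R (m * q) J (F m)) @ \oo --> cond J (nu w k) + cond J (nu_tilde w k).
  by rewrite sumF; apply: cvgD; [apply: cvg_nu_mean | apply: cvg_nu_tilde_mean].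
rewrite -(cvg_lim (@norm_hausdorff _ _) lim1).
exact: (cvg_lim (@norm_hausdorff _ _) lim2).
Qed.

Variable K : nat.
Let N := K.+1.
Let nR m : R := (m * q)%:R.

Lemma cvg_scan_deficit :
  (fun m => nR m * (gamma P Pi w k N - scan_mean N m)) @ \oo -->
  N%:R / 2 * cond K (nu w k).
Proof.
rewrite (_ : N%:R / 2 * _ = 2 * (N%:R / 4 * cond K (nu w k))); last by field.
rewrite (_ : (fun m => _) = fun m => q%:R * m%:R * (gamma P Pi w k N - scan_mean N m));
  last first.
  by apply/funext => m; rewrite /nR natrM [_%:R * q%:R]mulrC.
apply: cvg_doubling; rewrite ?ltr0n //; first exact: cvg_scan_mean.
apply: (cvg_close (v := fun m => N%:R / 4 * nu_mean K m)
  (b := err (N%:R * K%:R / 2 * (8 * K%:R ^+ 2)))).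
- move=> m m0.
  have := mean_scan_refine R K (n_gt0 m0) (l_gt0 m0) k2.
  rewrite !mulnA [q%:R * m%:R]mulrC -[m%:R * q%:R]natrM => /le_trans; apply.
  by rewrite /err -[leRHS]mulrA ler_wpM2l ?bad_mean_le // mulr_ge0 ?mulr_ge0.
- exact: cvg_err.
- by apply: cvgM; [exact: cvg_cst | exact: cvg_nu_mean].
Qed.

Definition clash_mean (U : nat -> pred (seq nat)) m : R :=
  mean R (m * q) N (fun s => ~~ uniq s && U m s).

Lemma cvg_clash_mean (U : nat -> pred (seq nat)) (v : nat -> R) (L : R) :
  (forall m, symmetric_stat (U m)) ->
  (forall m, (0 < m)%N -> mean R (m * q) K (fun s => \sum_(a <- s) U m (a :: s))%N = v m) ->
  v @ \oo --> L ->
  (fun m => nR m * clash_mean U m) @ \oo --> N%:R / 2 * L.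
Proof.
move=> symU vE vL.
apply: (cvg_close (v := fun m => N%:R / 2 * v m) (b := err (N%:R * K%:R * (8 * K%:R ^+ 2)))).
- move=> m m0; rewrite -vE //.
  apply: le_trans (mean_coincidence R K (n_gt0 m0) (symU m)) _.
  rewrite /err -[leRHS]mulrA ler_wpM2l ?mulr_ge0 //.
  apply: le_trans (bad_mean_le K m0); apply: le_mean => f.
  by rewrite /grid_good; case: uniq.
- exact: cvg_err.
- by apply: cvgM; [exact: cvg_cst | exact: vL].
Qed.

Let scans m := grid_scan_ge (m * q) (m * p) k.

Lemma cvg_clash_scan :
  (fun m => nR m * clash_mean scans m) @ \oo -->
  N%:R / 2 * (K%:R * gamma P Pi w k K + cond K (nu_tilde w k)).
Proof.
apply: (@cvg_clash_mean scans (fun m => K%:R * scan_mean K m + nu_tilde_mean K m)).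
- by move=> m; apply: grid_scan_ge_sym.
- move=> m m0; rewrite /scan_mean /nu_tilde_mean -meanM -meanD /mean; congr (_%:R / _).
  by apply: eq_total => f; rewrite sum_double_scan size_cells.
- apply: cvgD; last exact: cvg_nu_tilde_mean.
  by apply: cvgM; [exact: cvg_cst | exact: cvg_scan_mean].
Qed.

Lemma cvg_clash : (fun m => nR m * clash_mean (fun _ _ => true) m) @ \oo
  --> (N%:R / 2 * K%:R : R).
Proof.
apply: (@cvg_clash_mean _ (fun=> K%:R)) => //; last exact: cvg_cst.
move=> m m0; transitivity (K%:R * mean R (m * q) K (fun=> 1%N)); last first.
  by rewrite mean_1 ?mulr1 ?n_gt0.
rewrite -meanM /mean; congr (_%:R / _).
by apply: eq_total => f; rewrite muln1 big_const_seq count_predT size_cells iter_addn_0 mul1n.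
Qed.

Lemma cvg_clash0 : clash_mean (fun _ _ => true) @ \oo --> (0 : R).
Proof.
apply: (cvg_close (v := fun=> 0) 
  (b := fun m => 2 * (nR m * clash_mean (fun _ _ => true) m) * harmonic m)).
- move=> m m0; rewrite subr0 ger0_norm ?mean_ge0 //.
  have h1 : 1 <= 2 * nR m * harmonic m.
    by rewrite /harmonic /= ler_pdivlMr ?ltr0n // mul1r /nR -natrM ler_nat; clear -m0 q0; nia.
  have := ler_wpM2r (mean_ge0 R (m * q) N (fun s => ~~ uniq s && true)) h1.
  by rewrite mul1r /clash_mean; set D := mean _ _ _ _; lra.
- rewrite -(mulr0 (2 * (N%:R / 2 * K%:R))); apply: cvgM; last exact: cvg_harmonic.
  by apply: cvgM; [exact: cvg_cst | exact: cvg_clash].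
- exact: cvg_cst.
Qed.

(** With sigma the probability of a collision together with a scan of at least
    k, and delta that of a collision, gamma_discrete is
    (scan_mean - sigma) / (1 - delta), where sigma and delta are of order
    1 / n. *)
Lemma cvg_discretization :
  (fun m => nR m * (scan_mean N m - gamma_discrete R N (m * q) (m * p) k)) @ \oo -->
  N%:R / 2 * (K%:R * gamma P Pi w k K + cond K (nu_tilde w k))
   - gamma P Pi w k N * (N%:R / 2 * K%:R).
Proof.
pose sigma := clash_mean scans; pose delta := clash_mean (fun _ _ => true).
have E m : (0 < m)%N -> 1 - delta m != 0 ->
   nR m * (scan_mean N m - gamma_discrete R N (m * q) (m * p) k) =
   (nR m * sigma m - scan_mean N m * (nR m * delta m)) / (1 - delta m).
  move=> m0 d1.
  have nN : ((m * q)%:R : R) ^+ N != 0.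
    by rewrite expf_eq0 pnatr_eq0 (gtn_eqF (n_gt0 m0)) andbF.
  have -> : gamma_discrete R N (m * q) (m * p) k = (scan_mean N m - sigma m) / (1 - delta m).
    rewrite gamma_discreteE ?(ltnW k2) //.
    have -> : scan_mean N m - sigma m = mean R (m * q) N (fun s => uniq s && scans m s).
      apply/eqP; rewrite subr_eq -meanD /scan_mean /mean; apply/eqP; congr (_%:R / _).
      by apply: eq_total => f; rewrite /scans; case: uniq; rewrite ?addn0.
    have -> : 1 - delta m = mean R (m * q) N uniq.
      apply/eqP; rewrite subr_eq -meanD -[X in X == _](mean_1 R N (n_gt0 m0)) /mean; apply/eqP;
        congr (_%:R / _).
      by apply: eq_total => f; case: uniq.
    by rewrite /mean -mulf_div divff ?mulr1 // invr_eq0.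
  by field.
apply: cvg_trans (_ : (fun m =>
  (nR m * sigma m - scan_mean N m * (nR m * delta m)) / (1 - delta m)) @ \oo --> _).
  apply: near_eq_cvg; near=> m; apply/esym/E; first by near: m; exists 1%N.
  rewrite gt_eqF // subr_gt0; near: m.
  by apply: (cvgr_lt (0 : R) cvg_clash0).
rewrite -[X in _ --> X]divr1; apply: cvgM.
  by apply: cvgB; [exact: cvg_clash_scan | apply: cvgM;
    [exact: cvg_scan_mean | exact: cvg_clash]].
apply: cvgV; first exact: oner_neq0.
by rewrite -[X in _ --> X]subr0; apply: cvgB; [exact: cvg_cst | exact: cvg_clash0].
Unshelve. all: by end_near. Qed.

End Limits.

(** * The first-order expansion *)

Unset Implicit Arguments.
Set Strict Implicit.

Theorem theorem3p1 (R : realType) (p q : nat) (hp : (0 < p)%N)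
    (hpq : (p < q)%N) (hcop : coprime p q) (N k : nat) (hk : (2 <= k)%N)
    (hN : (k <= N)%N) (lambda : R) (hlambda : 0 < lambda)
    (d : measure_display) (T : measurableType d) (P : probability T R)
    (Pi : T -> seq R) (hPi : poisson_process P lambda Pi) :
  let w : R := p%:R / q%:R in
  (fun m : nat => (m * q)%:R *
     (gamma P Pi w k N - gamma_discrete R N (m * q) (m * p) k)) @ \oo -->
  2^-1 * N%:R * (N%:R - 1) * (gamma P Pi w k (N - 1) - gamma P Pi w k N)
  + 2^-1 * N%:R *
    cond_expectation P
      (fun om => (nu w k (Pi om) + nu_tilde w k (Pi om))%:R)
      [set om | size (Pi om) = (N - 1)%N].
Proof.
move=> w; case: N hN => [|K] hN; first by lia.
have -> : (K.+1 - 1)%N = K by lia.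
have -> : cond_expectation P (fun om => (nu w k (Pi om) + nu_tilde w k (Pi om))%:R)
    [set om | size (Pi om) = K] =
  cond_expectation P (fun om => (nu w k (Pi om))%:R) [set om | size (Pi om) = K] +
  cond_expectation P (fun om => (nu_tilde w k (Pi om))%:R) [set om | size (Pi om) = K].
  by rewrite (cond_nu_add k hp hpq hlambda hPi).
have lim1 := cvg_scan_deficit hp hpq hk hlambda hPi (K := K).
have lim2 := cvg_discretization hp hpq hk hlambda hPi (K := K).
pose n m : R := (m * q)%:R; pose g m := scan_mean R p q k K.+1 m.
rewrite (_ : (fun m => _) = (fun m => n m * (gamma P Pi w k K.+1 - g m)) \+
    (fun m => n m * (g m - gamma_discrete R K.+1 (m * q) (m * p) k))); last first.
  by apply/funext => m; rewrite /= -mulrDr addrA subrK.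
set c1 := cond_expectation _ _ _; set c2 := cond_expectation _ _ _.
rewrite [X in _ --> X](_ : _ = K.+1%:R / 2 * c1 +
    (K.+1%:R / 2 * (K%:R * gamma P Pi w k K + c2)
     - gamma P Pi w k K.+1 * (K.+1%:R / 2 * K%:R))); first exact: cvgD lim1 lim2.
by rewrite -natr1; field.
Qed.
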